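(* Let $U=\sum_{j=0}^3c_j\sigma_j\otimes\sigma_j$ be a normalized two-qubit unitary with $c_2=c_3$ (equivalently $y=z$). Then $$K_E(U)=\max_{\alpha,\beta\in[0,\pi/2]}E(\varphi(\alpha,\beta;\tfrac{\pi}{2},\tfrac{\pi}{2})),$$ i.e. the maximum in the definition of $K_E(U)$ is attained at an input of the form $(\cos\alpha|00\rangle+\sin\alpha|11\rangle)_{AR_A}\otimes(\cos\beta|00\rangle+\sin\beta|11\rangle)_{BR_B}$.
   Context: Pauli matrices: $\sigma_0=I$, $\sigma_1=\begin{pmatrix}0&1\\1&0\end{pmatrix}$, $\sigma_2=\begin{pmatrix}0&-i\\i&0\end{pmatrix}$, $\sigma_3=\begin{pmatrix}1&0\\0&-1\end{pmatrix}$. For real $x,y,z$ set $c_0=\cos x\cos y\cos z+i\sin x\sin y\sin z$, $c_1=\cos x\sin y\sin z+i\sin x\cos y\cos z$, $c_2=\sin x\cos y\sin z+i\cos x\sin y\cos z$, $c_3=\sin x\sin y\cos z+i\cos x\cos y\sin z$, and $U=\sum_{j=0}^3c_j\sigma_j\otimes\sigma_j$ acting on qubits $A,B$. $U$ is called normalized if $\pi/4\ge x\ge y\ge z\ge0$ and $0<y<\pi/4$. The entangling power is $K_E(U)=\max E\big(U(|\phi\rangle_{AR_A}\otimes|\psi\rangle_{BR_B})\big)$, the maximum over pure states on $AR_A$ and $BR_B$ with arbitrary finite-dimensional ancillas $R_A,R_B$ ($U$ acting on $A,B$), where $E(|\chi\rangle)=S(\mathrm{Tr}_{AR_A}|\chi\rangle\langle\chi|)$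 is the von Neumann entropy, base-2 logarithm. $E(\varphi(\alpha,\beta;\frac{\pi}{2},\frac{\pi}{2}))$ denotes $E$ of $U\big((\cos\alpha|00\rangle+\sin\alpha|11\rangle)_{AR_A}\otimes(\cos\beta|00\rangle+\sin\beta|11\rangle)_{BR_B}\big)$ with $R_A,R_B$ qubits. *)

(* Defs.v *)
From HB Require Import structures.
From mathcomp Require Import all_boot all_order all_algebra.
From mathcomp Require Import all_classical all_reals all_analysis.
From mathcomp Require Import complex.
Set Implicit Arguments. Unset Strict Implicit. Unset Printing Implicit Defensive.
Import Order.TTheory GRing.Theory Num.Theory.
Local Open Scope ring_scope.
Local Open Scope complex_scope.

Section QDefs.
Variable R : realType.
Local Notation C := R[i].

(* base-2 logarithm; [ln 0 = 0] in mathcomp-analysis, so 0 * log2 0 = 0 *)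
Definition log2 (t : R) : R := ln t / ln 2.

(* von Neumann entropy (base 2) of a density operator rho on a finite index
   set I: -sum_k lambda_k log2 lambda_k where the lambda_k are the eigenvalues
   of rho given by a spectral decomposition rho = V diag(lambda) V^*, V unitary.
   (For a Hermitian rho the eigenvalue multiset, hence the value, is unique.) *)
Definition vN_entropy (I : finType) (rho : I -> I -> C) : R :=
  xget 0%R [set s : R | exists (V : I -> I -> C) (lam : I -> R),
     (forall k l, \sum_(m : I) conjc (V m k) * V m l = (k == l)%:R) /\
     (forall p q, rho p q = \sum_(k : I) V p k * (lam k)%:C * conjc (V q k)) /\
     s = - \sum_(k : I) lam k * log2 (lam k)].

Definition coefU (x y z : R) (j : 'I_4) : C :=
  match val j with
  | 0 => (cos x * cos y * cos z) +i* (sin x * sin y * sin z)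
  | 1 => (cos x * sin y * sin z) +i* (sin x * cos y * cos z)
  | 2 => (sin x * cos y * sin z) +i* (cos x * sin y * cos z)
  | _ => (sin x * sin y * cos z) +i* (cos x * cos y * sin z)
  end.

Definition pauli (j : 'I_4) (r s : 'I_2) : C :=
  match val j, val r, val s with
  | 0, 0, 0 => 1 | 0, 1, 1 => 1
  | 1, 0, 1 => 1 | 1, 1, 0 => 1
  | 2, 0, 1 => - 'i | 2, 1, 0 => 'i
  | 3, 0, 0 => 1 | 3, 1, 1 => -1
  | _, _, _ => 0
  end.

(* Matrix element <i j | U | i' j'> of U = sum_j c_j sigma_j (x) sigma_j
   (first tensor factor: qubit A, second: qubit B). *)
Definition Uel (x y z : R) (i j i' j' : 'I_2) : C :=
  \sum_(k < 4) coefU x y z k * pauli k i i' * pauli k j j'.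

(* a pure state on A R_A is a unit vector phi : 'I_2 -> 'I_a -> C,
   phi i r = coefficient of |i>_A |r>_{R_A} *)
Definition unit_state (a : nat) (phi : 'I_2 -> 'I_a -> C) : Prop :=
  \sum_(i < 2) \sum_(r < a) phi i r * conjc (phi i r) = 1.

(* output state U (|phi>_{A R_A} (x) |psi>_{B R_B}), coefficient of
   |i>_A |ra>_{R_A} |j>_B |rb>_{R_B} *)
Definition out_state (x y z : R) (a b : nat) (phi : 'I_2 -> 'I_a -> C)
  (psi : 'I_2 -> 'I_b -> C) (i : 'I_2) (ra : 'I_a) (j : 'I_2) (rb : 'I_b) : C :=
  \sum_(i' < 2) \sum_(j' < 2) Uel x y z i j i' j' * phi i' ra * psi j' rb.

Definition reduced_BRB (x y z : R) (a b : nat) (phi : 'I_2 -> 'I_a -> C)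
  (psi : 'I_2 -> 'I_b -> C) (p q : 'I_2 * 'I_b) : C :=
  \sum_(i < 2) \sum_(ra < a)
     out_state x y z phi psi i ra p.1 p.2 * conjc (out_state x y z phi psi i ra q.1 q.2).

Definition Eout (x y z : R) (a b : nat) (phi : 'I_2 -> 'I_a -> C)
  (psi : 'I_2 -> 'I_b -> C) : R :=
  vN_entropy (reduced_BRB x y z phi psi).

Definition achievable (x y z : R) : set R :=
  [set e | exists (a b : nat) (phi : 'I_2 -> 'I_a -> C) (psi : 'I_2 -> 'I_b -> C),
     unit_state phi /\ unit_state psi /\ e = Eout x y z phi psi].

(* entangling power K_E(U) (the supremum, which the theorem shows is a max) *)
Definition KE (x y z : R) : R := sup (achievable x y z).

Definition schmidt2 (t : R) (i r : 'I_2) : C :=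
  if i == r then (if val i == 0%N then (cos t)%:C else (sin t)%:C) else 0.

Definition Ephi (x y z alpha beta : R) : R :=
  Eout x y z (schmidt2 alpha) (schmidt2 beta).

End QDefs.

(* Main.v *)
Require Import Defs.
From HB Require Import structures.
From mathcomp Require Import all_boot all_order all_algebra.
From mathcomp Require Import all_classical all_reals all_analysis.
From mathcomp Require Import complex.
From mathcomp Require Import ring lra.
Import Order.TTheory GRing.Theory Num.Theory.
Import numFieldNormedType.Exports.
Set Implicit Arguments.
Unset Strict Implicit.
Unset Printing Implicit Defensive.
Local Open Scope ring_scope.
Local Open Scope complex_scope.

(**
The nonzero output spectrum is that of a 4x4 matrix depending only on the Bloch vectors [a], [b]
of the two input qubits.  Its trace is 1 and, writing [S = sin(2y)^2], [T = sin(2x)^2],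
[t = sin 2x cos 2y], [s = cos 2x sin 2y], [q = (1-|a|^2)(1-|b|^2)],
[v = t (1 - a1 b1) - s (a2 b2 + a3 b3)] and [k = cos 2y (a1 - b1) + sin 2y (a2 b3 - a3 b2)],
its other elementary symmetric functions are
  8 e2 = - S^2 q + 2 S (2 - |a|^2 - |b|^2) + 2 v^2 - 2 (T - S) k^2,
  16 e3 = S q (S + 2 t v)   and   256 e4 = S^2 (S^2 + 4 t^2) q^2.

The entropy is increasing in e2, e3, e4 at fixed trace, because
- x ln x = int_0^oo (ln (1 + t x) - x ln (1 + t)) / t^2 dt turns it into an integral of
ln det (1 + t rho).  So it suffices to find, for each [(a, b)], an antiparallel pair
[a = (0, 0, sqrt u)], [b = - a] whose e2, e3, e4 are all at least as large.  With [U = |a||b|] one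
can take [u = 0] if [S + T >= 1], and otherwise [u = U - max(0, v - t - s U) / t].

Antiparallel pairs along the third axis are exactly the Schmidt inputs with
[beta = pi/2 - alpha]; their spectrum is explicit and continuous in [u], so a best [u] exists.
*)

(** * Domination by antiparallel Bloch vectors *)

(** The natural candidate is [u = U]: at fixed [U], both [q] and the part of e2 without [v] and [k]
    are largest when [|a| = |b|]. Only [v] can spoil it. An excess [v > t + s U] forces
    [a1 b1 <= 0], since the second and third axes couple with weight [s <= t] only. Such inputs pay
    through [- 2 (T - S) k^2], because [k] contains [cos 2y (a1 - b1)]. The term [a2 b3 - a3 b2] of
    [k] may cancel this cost, but a large value of it lowers [- (a2 b2 + a3 b3)] and hence [v]. The
    trade-off is a quadratic form in [(a1 - b1) / 2] and [a2 b3 - a3 b2], and the hard inequalities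
    are bounds on its discriminant. For [S + T >= 1], shortening the antiparallel pair from [U] to 0
    never lowers e2, and this gain is available to pay for the excess; otherwise only a shortening
    proportional to the excess is used. Ancillas of arbitrary size disappear through the identity
    det(1 + AB) = det(1 + BA), and the entropy comparison accepts spectra indexed by different
    finite types. *)

Lemma binary_form_ge0 (R : realFieldType) (A B C X r : R) :
  0 <= A -> 0 <= C -> B ^+ 2 <= A * C ->
  0 <= A * X ^+ 2 + 2 * B * X * r + C * r ^+ 2.
Proof.
move=> A0 C0 BAC.
have [AE|An0] := eqVneq A 0.
  have B0 : B = 0.
    by apply/eqP; rewrite -sqrf_eq0 eq_le sqr_ge0 andbT (le_trans BAC) // AE mul0r.
  by rewrite AE B0; have := mulr_ge0 C0 (sqr_ge0 r); lra.
have Ap : 0 < A by rewrite lt_neqAle eq_sym An0.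
rewrite -(pmulr_rge0 _ Ap).
have -> : A * (A * X ^+ 2 + 2 * B * X * r + C * r ^+ 2) =
  (A * X + B * r) ^+ 2 + (A * C - B ^+ 2) * r ^+ 2 by ring.
by rewrite addr_ge0 ?sqr_ge0 // mulr_ge0 ?sqr_ge0 // subr_ge0.
Qed.

(** Multiplied by [S], this is the discriminant condition at [ka = 0] for the form in [X] and [r]
    that closes [strong_coupling_bound]: [a0] and [S * b] are lower bounds, free of [t] and [U], for
    the quantities called [al0] and [beta] there. *)
Lemma strong_coupling_discriminant_unpolarized (R : realFieldType) (S mu sg de Y1 b a0 : R) :
  0 < S -> 0 <= mu -> mu <= 1 ->
  sg = S * (1 + mu ^+ 2) / 2 -> de = 1 - 2 * sg -> 0 <= de ->
  Y1 = 2 * (1 - mu) * (1 - sg) + S * mu ^+ 2 / 2 ->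
  b = (2 - mu) * (1 - sg) + 3 / 2 * mu ^+ 2 * S ->
  a0 = 2 * de * (1 - 2 * S) + S * Y1 ->
  4 * de ^+ 2 * (1 - S) <= a0 * (de + b).
Proof.
move=> S0 mu0 mu1 sgE deE de0 Y1E bE a0E.
have Smu : S * (1 + mu ^+ 2) <= 1 by move: de0; rewrite deE sgE; lra.
have S0' := ltW S0.
have mu2 : 0 <= mu * mu * S by rewrite !mulr_ge0.
have S1 : S <= 1 by move: Smu mu2; clear; lra.
have Sm : S * mu <= 1 / 2.
  move: Smu (mulr_ge0 S0' (sqr_ge0 (1 - mu))); clear; lra.
have mum : 0 <= mu * (1 - mu) by rewrite mulr_ge0 ?subr_ge0.
have [e eE] : exists e : R, e = (1 - mu) + mu * S / 2 * (1 - mu + mu ^+ 2).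
  by exists ((1 - mu) + mu * S / 2 * (1 - mu + mu ^+ 2)).
have [M ME] : exists M, M = 2 * (1 - S) + e by exists (2 * (1 - S) + e).
have -> : de + b = M by rewrite ME eE bE deE sgE; field.
have e0 : 1 - mu <= e.
  rewrite eE lerDl !mulr_ge0 ?invr_ge0 //; move: mu1 (sqr_ge0 mu); clear; lra.
have M0 : 0 <= M by rewrite ME; move: S1 e0 mu1; clear; lra.
have M3 : M <= 3.
  have : 0 <= S * mu * (mu * (1 - mu)) by rewrite !mulr_ge0 ?subr_ge0.
  have : S * mu <= S by rewrite ler_piMr.
  rewrite ME eE; move: S0' mu0; clear; lra.
have M4 : mu ^+ 2 * M <= 2 * (1 + mu ^+ 2).
  have : 0 <= mu ^+ 2 * (3 - M) by rewrite mulr_ge0 ?sqr_ge0 ?subr_ge0.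
  move: mu1 mum; clear; lra.
(* Apart from visibly nonnegative terms, the gap is a binary quadratic form in [de] and 1, and [M4]
   is its discriminant condition. *)
have K : a0 * M - 4 * de ^+ 2 * (1 - S) =
   2 * de ^+ 2 * (e - (1 - mu)) +
   2 * (1 - mu) * (1 * de ^+ 2 + 2 * (- (mu * S * M / 2)) * de * 1 + (sg * S * M) * 1 ^+ 2) +
   S * (S * mu ^+ 2 / 2) * M.
  by rewrite ME eE a0E Y1E deE sgE; field.
have sg0 : 0 <= sg by rewrite sgE !mulr_ge0 ?invr_ge0 ?addr_ge0 ?sqr_ge0.
rewrite -subr_ge0 K.
apply: addr_ge0; last by rewrite !mulr_ge0 ?sqr_ge0 ?invr_ge0.
apply: addr_ge0; first by rewrite !mulr_ge0 ?sqr_ge0 // subr_ge0.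
apply: mulr_ge0; first by rewrite mulr_ge0 ?subr_ge0.
apply: binary_form_ge0 => //; first by rewrite !mulr_ge0.
have -> : (- (mu * S * M / 2)) ^+ 2 = (S ^+ 2 * M / 4) * (mu ^+ 2 * M) by field.
have -> : 1 * (sg * S * M) = (S ^+ 2 * M / 4) * (2 * (1 + mu ^+ 2)) by rewrite sgE; field.
by apply: ler_wpM2l => //; rewrite !mulr_ge0 ?sqr_ge0 ?invr_ge0.
Qed.

(** The companion for [ka = 1]: [a1] is a lower bound for the coefficient of [X ^+ 2] there. Added
    to the unpolarized inequality, it controls the mixed coefficient, that of [ka * (1 - ka)], in
    the discriminant condition. *)
Lemma strong_coupling_discriminant_polarized (R : realFieldType) (S mu sg de Y1 b a0 a1 : R) :
  0 < S -> 0 <= mu -> mu <= 1 ->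
  sg = S * (1 + mu ^+ 2) / 2 -> de = 1 - 2 * sg -> 0 <= de ->
  Y1 = 2 * (1 - mu) * (1 - sg) + S * mu ^+ 2 / 2 ->
  b = (2 - mu) * (1 - sg) + 3 / 2 * mu ^+ 2 * S ->
  a0 = 2 * de * (1 - 2 * S) + S * Y1 ->
  a1 = de * (1 - 2 * S) + S ^+ 2 - S ^+ 2 * mu ^+ 2 / 2 ->
  a0 * de <= a1 * (de + b).
Proof.
move=> S0 mu0 mu1 sgE deE de0 Y1E bE a0E a1E.
have S0' := ltW S0.
have deE' : de = 1 - S - S * mu ^+ 2 by rewrite deE sgE; field.
have mu2 : 0 <= S * mu ^+ 2 by rewrite mulr_ge0 ?sqr_ge0.
have m1 : 0 <= 1 - mu by rewrite subr_ge0.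
have musq : 0 <= mu * (1 - mu) by rewrite mulr_ge0.
have deS : de <= 1 - S by rewrite deE'; move: mu2; clear; lra.
have S1 : 0 <= 1 - S by move: deS de0; clear; lra.
have [e eE] : exists e : R, e = (1 - mu) + mu * S / 2 * (1 - mu + mu ^+ 2).
  by exists ((1 - mu) + mu * S / 2 * (1 - mu + mu ^+ 2)).
have e0 : 1 - mu <= e.
  rewrite eE lerDl !mulr_ge0 ?invr_ge0 //; move: mu1 (sqr_ge0 mu); clear; lra.
have JE : a1 * (de + b) - a0 * de = de * (1 - 2 * S) * (e + 2 * S * mu ^+ 2)
    + S ^+ 2 * (1 - mu ^+ 2 / 2) * (2 * (1 - S) + e)
    - de * S * ((1 - mu) * (1 + de) + S * mu ^+ 2 / 2).
  by rewrite a1E a0E Y1E bE eE deE sgE; field.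
rewrite -subr_ge0 JE.
have mm : mu ^+ 2 <= mu by move: musq; clear; lra.
have h1 : 0 <= 1 - mu ^+ 2 / 2 by move: mm mu1; clear; lra.
have SS := sqr_ge0 S.
have he : 0 <= e - (1 - mu) by rewrite subr_ge0.
have hd : 0 <= 1 - S - de by move: deS; clear; lra.
(* The cubic is the value at [mu = 0], where [de = 1 - S], of the decisive coefficient in each half
   of the case split on [S]. *)
have f0 : 0 <= 1 - 5 * S + 8 * S ^+ 2 - 3 * S ^+ 3.
  have h2 := sqr_ge0 (1 - 5 / 2 * S).
  have [Sh|Sh] := leP S (1 / 2).
    have : 0 <= S ^+ 2 * (1 / 2 - S) by rewrite mulr_ge0 // subr_ge0.
    move: h2 SS; clear; lra.
  have : 0 <= (1 - S) ^+ 2 * S by rewrite mulr_ge0 ?sqr_ge0.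
  have : 0 <= (1 - S) * (S - 1 / 2) by rewrite mulr_ge0 // subr_ge0 ltW.
  have := sqr_ge0 (S - 1 / 2).
  move: Sh S0' S1; clear; nra.
have [Sh|/ltW Sh] := leP S (1 / 2).
  have Sh' : 0 <= 1 - 2 * S by move: Sh; clear; lra.
  have c1 : 0 <= de * (1 - 2 * S) * (e - (1 - mu)) by rewrite !mulr_ge0.
  have c2 : 0 <= de * (1 - 2 * S) * (2 * (S * mu ^+ 2)) by rewrite !mulr_ge0.
  have c3 : 0 <= S ^+ 2 * (1 - mu ^+ 2 / 2) * (e - (1 - mu)) by rewrite !mulr_ge0.
  have c4 : 0 <= S ^+ 2 * (mu ^+ 2 / 2) * (1 - S - de).
    by rewrite !mulr_ge0 ?sqr_ge0 ?invr_ge0.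
  have c5 : 0 <= (1 - mu) * (S * de) * (1 - S - de) by rewrite !mulr_ge0.
  have c6 : 0 <= (1 - mu) * ((1 - 4 * S + S ^+ 2) * de + S ^+ 2 * (2 * (1 - S) + 1)).
    rewrite mulr_ge0 //.
    have [g0|g0] := leP 0 (1 - 4 * S + S ^+ 2).
      by rewrite addr_ge0 // mulr_ge0 //; move: S1; clear; lra.
    have : 0 <= - (1 - 4 * S + S ^+ 2) * (1 - S - de).
      by rewrite mulr_ge0 // oppr_ge0 ltW.
    move: f0; clear; lra.
  have c7 : 0 <= S ^+ 2 * (1 - S) * (2 * mu - 3 / 2 * mu ^+ 2) + S ^+ 2 * (1 - mu) * (- mu ^+ 2 / 2).
    have : 0 <= S ^+ 2 * (1 / 2 - S) * (2 * mu - 3 / 2 * mu ^+ 2).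
      by rewrite !mulr_ge0 //; [move: Sh|move: mu0 mm]; clear; lra.
    have : 0 <= S ^+ 2 * (mu - 3 / 4 * mu ^+ 2 - (1 - mu) * mu ^+ 2 / 2).
      rewrite mulr_ge0 //.
      have : 0 <= (1 - mu) * (mu - mu ^+ 2) by rewrite mulr_ge0 // subr_ge0.
      move: mm mu0; clear; lra.
    clear; lra.
  move: c1 c2 c3 c4 c5 c6 c7; clear; lra.
have Sh' : 0 <= 2 * S - 1 by move: Sh; clear; lra.
have e1 : 0 <= 1 - e - mu ^+ 2 / 2.
  have h2 : 0 <= mu * (1 - S) by rewrite mulr_ge0.
  have h3 : 0 <= mu * S * (mu * (1 - mu)) by rewrite !mulr_ge0.
  by rewrite eE; move: h2 h3 mm mu0; clear; lra.
have e00 : 0 <= e by move: e0 m1; clear; lra.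
have b1 : 1 - 5 * S + 8 * S ^+ 2 - 3 * S ^+ 3 <=
    S ^+ 2 * (1 - mu ^+ 2 / 2) * (3 - 2 * S) - de * (3 * S - 1 + S * de).
  rewrite -subr_ge0.
  have -> : S ^+ 2 * (1 - mu ^+ 2 / 2) * (3 - 2 * S) - de * (3 * S - 1 + S * de) -
      (1 - 5 * S + 8 * S ^+ 2 - 3 * S ^+ 3) =
      (1 - S - de) * (S * de + (5 * S - 2) / 2) by rewrite deE'; field.
  rewrite mulr_ge0 // addr_ge0 ?mulr_ge0 ?invr_ge0 //; move: Sh; clear; lra.
have c1 : 0 <= S ^+ 2 * (1 - mu ^+ 2 / 2) * (2 * (1 - S)) * (1 - e - mu ^+ 2 / 2).
  by rewrite !mulr_ge0.
have c2 : 0 <= de * S * (1 + de) * (e - (1 - mu)).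
  by rewrite !mulr_ge0 // addr_ge0.
have c3 : 0 <= e * (S ^+ 2 * (1 - mu ^+ 2 / 2) * (3 - 2 * S) - de * (3 * S - 1 + S * de)
    - (1 - 5 * S + 8 * S ^+ 2 - 3 * S ^+ 3)).
  by rewrite mulr_ge0 // subr_ge0.
have c4 : 0 <= e * (1 - 5 * S + 8 * S ^+ 2 - 3 * S ^+ 3) +
   mu ^+ 2 * ((1 - S) * S ^+ 2 * (1 - mu ^+ 2 / 2) - de * (9 / 2 * S ^+ 2 - 2 * S)).
  have B2 : (1 - S) * S ^+ 2 * (1 - mu ^+ 2 / 2) - de * (9 / 2 * S ^+ 2 - 2 * S) =
     S * (1 - S) * (2 - 7 / 2 * S) + 5 / 2 * (S * mu ^+ 2) * (S * (2 * S - 1)).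
    by rewrite deE'; field.
  have B3 : 0 <= mu ^+ 2 * (5 / 2 * (S * mu ^+ 2) * (S * (2 * S - 1))).
    by rewrite !mulr_ge0 ?invr_ge0 ?sqr_ge0.
  rewrite B2 (mulrDr (mu ^+ 2)) addrA addr_ge0 //.
  have [S4|S4] := leP S (4 / 7).
    by rewrite addr_ge0 // !mulr_ge0 ?sqr_ge0 //; move: S4; clear; lra.
  have d1 : 0 <= S * (2 * e - (1 - mu ^+ 2)) * (1 - 5 * S + 8 * S ^+ 2 - 3 * S ^+ 3).
    rewrite !mulr_ge0 //; move: he (sqr_ge0 (1 - mu)); clear; lra.
  have d2 : 0 <= de * (1 - 5 * S + 8 * S ^+ 2 - 3 * S ^+ 3) by rewrite mulr_ge0.
  have d3 : 0 <= S * (1 - S) * (7 / 2 * S - 2) * de.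
    by rewrite !mulr_ge0 //; move: S4; clear; lra.
  (* Once [d2] and [d3] have absorbed the terms in [de], the quartic [(2 S - 1) (1 - 5 S + 8 S^2 - 3
     S^3) + S (1 - S)^2 (4 - 7 S)] remains. It is smallest close to 59/100, and the second factor is
     its rounded second-order Taylor quotient there. *)
  have d4 : 0 <= (S - 59 / 100) ^+ 2 *
      (574 / 100 + 434 / 100 * (1 - S) - 13 * (1 - S) ^+ 2).
    apply: mulr_ge0; first exact: sqr_ge0.
    have : 0 <= (1 - S) * (S - 4 / 7) by rewrite mulr_ge0 // subr_ge0 ltW.
    move: S4 S1; clear; lra.
  rewrite -(pmulr_rge0 _ (_ : 0 < 2 * S)); last by rewrite mulr_gt0.
  move: d1 d2 d3 d4 S1 S4 (sqr_ge0 (S - 59 / 100)); rewrite deE'; clear; lra.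
move: c1 c2 c3 c4; clear; lra.
Qed.

(* Here [S = sin(2y)^2], [t = sin 2x cos 2y], [s = cos 2x sin 2y], [de = t^2 - s^2],
   [U = |a||b|], [ka = - a1 b1], [m = - (a2 b2 + a3 b3)], [r = a2 b3 - a3 b2],
   [X = (a1 - b1) / 2] and [mu = cos 2x / sin 2y]; [mu <= 1] means [2x + 2y >= pi/2].
   The left side is the gain of [v^2] over the antiparallel input with the same [U]; after
   bounding [m], it is beaten because a quadratic form in [X] and [r] is nonnegative. *)
Lemma strong_coupling_bound (R : realFieldType) (cy sy S mu t s de U ka m r X y : R) :
  0 < S -> 0 <= mu -> mu <= 1 -> 0 <= t -> s = mu * S ->
  cy ^+ 2 = 1 - S -> sy ^+ 2 = S -> t ^+ 2 = (1 - mu ^+ 2 * S) * (1 - S) ->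
  de = 1 - S - mu ^+ 2 * S -> 0 <= de ->
  0 <= ka -> ka <= U -> U <= 1 -> m ^+ 2 + r ^+ 2 <= (U - ka) ^+ 2 ->
  ka <= X ^+ 2 ->
  y = 2 * S - S ^+ 2 - 2 * t * s + U * (S ^+ 2 / 2 - s ^+ 2) ->
  let ep := t * ka + s * m - s * U in
  0 <= y /\ (0 < ep ->
    ep * (2 * t + 2 * s * U + ep) <= de * (2 * cy * X + sy * r) ^+ 2 + U * y).
Proof.
move=> S0 mu0 mu1 t0 sE cyE syE tE deE de0 ka0 kaU U1 mr kX yE ep.
have S0' := ltW S0.
have U0 : 0 <= U := le_trans ka0 kaU.
have [sg sgE] : exists sg : R, sg = S * (1 + mu ^+ 2) / 2 by exists (S * (1 + mu ^+ 2) / 2).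
have deE2 : de = 1 - 2 * sg by rewrite deE sgE; field.
have mS : 0 <= mu ^+ 2 * S by rewrite mulr_ge0 ?sqr_ge0.
have S1 : 0 <= 1 - S by move: de0 mS; rewrite deE; clear; lra.
have sg1 : 0 <= 1 - sg by move: de0; rewrite deE2; clear; lra.
(* Arithmetic-geometric mean inequality for [1 - mu ^+ 2 * S] and [1 - S], whose mean is
   [1 - sg]. *)
have tsg : t <= 1 - sg.
  rewrite -(@ler_pXn2r _ 2) ?nnegrE // -subr_ge0 tE.
  have -> : (1 - sg) ^+ 2 - (1 - mu ^+ 2 * S) * (1 - S) = ((S - mu ^+ 2 * S) / 2) ^+ 2.
    by rewrite sgE; field.
  exact: sqr_ge0.
have s0 : 0 <= s by rewrite sE mulr_ge0.
have mu2 : mu ^+ 2 <= 1 by rewrite expr_le1.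
pose Y1 : R := 2 * (1 - mu) * (1 - sg) + S * mu ^+ 2 / 2.
pose b : R := (2 - mu) * (1 - sg) + 3 / 2 * mu ^+ 2 * S.
pose a0 : R := 2 * de * (1 - 2 * S) + S * Y1.
pose a1 : R := de * (1 - 2 * S) + S ^+ 2 - S ^+ 2 * mu ^+ 2 / 2.
have K0 := @strong_coupling_discriminant_unpolarized R S mu sg de Y1 b a0 S0 mu0 mu1 sgE deE2 de0 erefl erefl erefl.
have K1 := @strong_coupling_discriminant_polarized R S mu sg de Y1 b a0 a1 S0 mu0 mu1 sgE deE2 de0 erefl erefl erefl erefl.
have m1 : 0 <= 1 - mu by rewrite subr_ge0.
have mut : 0 <= S * mu * (1 - sg - t) by rewrite !mulr_ge0 ?subr_ge0.
have Uterm : 0 <= S ^+ 2 * (U * (1 / 2 - mu ^+ 2) + mu ^+ 2 / 2).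
  rewrite mulr_ge0 ?sqr_ge0 //.
  have h1 : 0 <= mu ^+ 2 * (1 - U) by rewrite mulr_ge0 ?sqr_ge0 // subr_ge0.
  have h2 : 0 <= U * (1 - mu ^+ 2) by rewrite mulr_ge0 // subr_ge0.
  by move: h1 h2; clear; lra.
(* [2 * U * y] is the gain in 8 e2 when the antiparallel pair passes from squared length [U] to
   0. *)
have yY : S * Y1 <= y.
  rewrite -subr_ge0.
  have -> : y - S * Y1 = 2 * (S * mu * (1 - sg - t)) + S ^+ 2 * (U * (1 / 2 - mu ^+ 2) + mu ^+ 2 / 2).
    by rewrite yE /Y1 sE sgE; field.
  by rewrite addr_ge0 // mulr_ge0.
have Y10 : 0 <= Y1 by rewrite /Y1 addr_ge0 // !mulr_ge0 ?invr_ge0 ?sqr_ge0.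
have y0 : 0 <= y by rewrite (le_trans _ yY) // mulr_ge0.
split => // ep0.
have [beta betaE] : exists beta : R, beta = (t + s) * s + y by exists ((t + s) * s + y).
have bb : S * b <= beta.
  rewrite -subr_ge0.
  have -> : beta - S * b = S * mu * (1 - sg - t) + S ^+ 2 * (U * (1 / 2 - mu ^+ 2) + mu ^+ 2 / 2).
    by rewrite betaE yE /b sE sgE; field.
  by rewrite addr_ge0.
have b0 : 0 < b.
  have mm1 : 1 <= 2 - mu by move: mu1; clear; lra.
  have sgh : 1 / 2 <= 1 - sg by move: de0; rewrite deE2; clear; lra.
  rewrite /b ltr_pwDl //; last by rewrite !mulr_ge0 ?invr_ge0 ?sqr_ge0.
  by rewrite mulr_gt0 //; [move: mm1|move: sgh]; clear; lra.
have bt0 : 0 <= beta by rewrite (le_trans _ bb) // mulr_ge0 // ltW.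
have db0 : 0 < de + b by rewrite ltr_wpDl.
have a00 : 0 <= a0.
  by rewrite -(pmulr_lge0 _ db0) (le_trans _ K0) // !mulr_ge0 ?sqr_ge0.
have a10 : 0 <= a1.
  by rewrite -(pmulr_lge0 _ db0) (le_trans _ K1) // mulr_ge0.
have [al0 al0E] : exists al0 : R, al0 = 2 * de * (1 - 2 * S) + y by exists (2 * de * (1 - 2 * S) + y).
have [al1 al1E] : exists al1 : R, al1 = al0 - (t - s) ^+ 2 by exists (al0 - (t - s) ^+ 2).
have A0 : a0 <= al0 by rewrite al0E /a0 lerD2l.
have al00 := le_trans a00 A0.
have A1 : a1 <= al1.
  rewrite -subr_ge0.
  have -> : al1 - a1 = S ^+ 2 * (U * (1 / 2 - mu ^+ 2) + mu ^+ 2 / 2).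
    rewrite al1E al0E yE /a1.
    have -> : (t - s) ^+ 2 = t ^+ 2 - 2 * t * s + s ^+ 2 by ring.
    by rewrite tE sE deE; field.
  by [].
have al10 := le_trans a10 A1.
have de2 : de ^+ 2 = (t - s) ^+ 2 * (t + s) ^+ 2.
  have -> : (t - s) ^+ 2 * (t + s) ^+ 2 = (t ^+ 2 - s ^+ 2) ^+ 2 by ring.
  by rewrite tE sE deE; congr (_ ^+ 2); ring.
have deQ : de = (t - s) * (t + s).
  have -> : (t - s) * (t + s) = t ^+ 2 - s ^+ 2 by ring.
  by rewrite tE sE deE; ring.
pose E : R := 4 * de ^+ 2 * S * (1 - S).
have KK0 : E <= al0 * (de * S + beta).
  apply: (@le_trans _ _ (a0 * (S * (de + b)))).
    have := ler_wpM2l S0' K0; rewrite /E; clear; lra.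
  apply: ler_pM => //; first by rewrite mulr_ge0 // ltW.
  by move: bb; clear; lra.
have KK1 : E <= al1 * (de * S) + (al0 + al1) * beta.
  apply: (@le_trans _ _ (a1 * (de * S) + (a0 + a1) * (S * b))).
    have := ler_wpM2l S0' K1; have := ler_wpM2l S0' K0; rewrite /E; clear; lra.
  apply: lerD; first by rewrite ler_wpM2r // mulr_ge0.
  by apply: ler_pM => //; first exact: addr_ge0; [by rewrite mulr_ge0 // ltW | exact: lerD].
have k1 : ka <= 1 := le_trans kaU U1.
have k1' : 0 <= 1 - ka by rewrite subr_ge0.
pose al : R := (1 - ka) * al0 + ka * al1.
(* Both sides are expanded in Bernstein form of degree 2 in [1 - ka] and [ka]; [KK0], [KK1] and
   [0 <= beta * al1] compare the three coefficients. *)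
have L : E * (1 - ka) <= al * (de * S * (1 - ka) + beta).
  have h0 : 0 <= (1 - ka) * ((1 - ka) * (al0 * (de * S + beta) - E)).
    by rewrite !mulr_ge0 // subr_ge0.
  have h1 : 0 <= (1 - ka) * (ka * (al1 * (de * S) + (al0 + al1) * beta - E)).
    by rewrite !mulr_ge0 // subr_ge0.
  have h2 : 0 <= ka * ka * (beta * al1) by rewrite !mulr_ge0.
  move: h0 h1 h2; rewrite /al; clear; lra.
have al_0 : 0 <= al by rewrite addr_ge0 // mulr_ge0.
have Uk : 0 <= U - ka by rewrite subr_ge0.
have mU : m <= U - ka.
  apply: le_trans (ler_norm m) _; rewrite -(@ler_pXn2r _ 2) ?nnegrE //.
  by rewrite real_normK ?num_real // (le_trans _ mr) // lerDl sqr_ge0.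
have r2 : r ^+ 2 <= (U - ka) * (1 - ka).
  apply: (@le_trans _ _ ((U - ka) ^+ 2)).
    by apply: le_trans mr; rewrite lerDr sqr_ge0.
  by rewrite expr2 ler_wpM2l // lerD2r.
have r3 : r ^+ 2 <= 2 * (U - ka - m) * (1 - ka).
  have h1 : 0 <= (U - ka - m) * (1 - U) by rewrite mulr_ge0 ?subr_ge0.
  have h2 : 0 <= (U - ka - m) ^+ 2 by exact: sqr_ge0.
  by move: mr h1 h2; clear; lra.
(* [rt] measures how much [r] keeps [m] below [U - ka]: [ep] loses at least [s * rt / 2]. At
   [ka = 1] the quotient is 0 by convention, and [r] vanishes too. *)
pose rt : R := r ^+ 2 / (1 - ka).
have [rt0 rtU rtm rtr] : [/\ 0 <= rt, rt <= U - ka, rt <= 2 * (U - ka - m) & r ^+ 2 = rt * (1 - ka)].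
  have [kE|kN] := eqVneq (1 - ka) 0.
    have r0 : r ^+ 2 = 0 by apply/eqP; rewrite eq_le sqr_ge0 andbT (le_trans r2) // kE mulr0.
    by rewrite /rt kE invr0 !mulr0 r0; split => //; rewrite mulr_ge0 // subr_ge0.
  have kp : 0 < 1 - ka by rewrite lt_neqAle eq_sym kN.
  by rewrite /rt; split; rewrite ?divr_ge0 ?sqr_ge0 ?ler_pdivrMr // divfK.
have D0 : 0 <= t - s.
  rewrite leNgt; apply/negP => D0.
  have h1 : (t - s) * ka <= 0 by rewrite mulr_le0_ge0 // ltW.
  have h2 : 0 <= s * (U - ka - m) by rewrite mulr_ge0 // subr_ge0.
  by move: ep0 h1 h2; rewrite /ep; clear; lra.
have epE : ep <= (t - s) * ka - s * rt / 2.
  have h : 0 <= s * (2 * (U - ka - m) - rt) by rewrite mulr_ge0 // subr_ge0.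
  by move: h; rewrite /ep; clear; lra.
have srt : 0 <= s * rt by rewrite mulr_ge0.
pose Th : R := 2 * (t + s) + (t - s) * ka.
have ThE : 2 * t + 2 * s * U + ep <= Th.
  have h : 0 <= s * (1 - U) by rewrite mulr_ge0 // subr_ge0.
  by move: h epE srt; rewrite /Th; clear; lra.
have T0 : 0 <= 2 * t + 2 * s * U + ep.
  have h : 0 <= s * U by rewrite mulr_ge0.
  by move: h t0 ep0; clear; lra.
have main : ep * (2 * t + 2 * s * U + ep) <= (t - s) * ka * Th - s * rt * (t + s).
  apply: (@le_trans _ _ (((t - s) * ka - s * rt / 2) * Th)).
    by apply: ler_pM => //; apply: ltW.
  have h : 0 <= s * rt * ((t - s) * ka) by rewrite (mulr_ge0 srt) // mulr_ge0.
  by move: h; rewrite /Th; clear; lra.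
apply: le_trans main _.
have Uy : (ka + rt) * y <= U * y.
  by rewrite ler_wpM2r //; move: rtU; clear; lra.
rewrite -subr_ge0.
(* What remains to be shown is [0 <= de * (2 * cy * X + sy * r) ^+ 2 + om * ka + beta * rt]. If [om]
   is negative, [ka <= X ^+ 2] turns this into a form in [X] and [r]. *)
pose om : R := y - 2 * de - (t - s) ^+ 2 * ka.
have [om0|om0] := leP 0 om.
  have h1 : 0 <= om * ka by rewrite mulr_ge0.
  have h2 : 0 <= de * (2 * cy * X + sy * r) ^+ 2 by rewrite mulr_ge0 ?sqr_ge0.
  have h3 : 0 <= beta * rt by rewrite mulr_ge0.
  by move: h1 h2 h3 Uy; rewrite /om betaE /Th deQ; clear; lra.
have h1 : 0 <= - om * (X ^+ 2 - ka) by rewrite mulr_ge0 ?subr_ge0 // oppr_ge0 ltW.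
have h2 : 0 <= al * X ^+ 2 + 2 * (2 * de * (cy * sy)) * X * r + de * S * r ^+ 2 + beta * rt.
  have [kE|kN] := eqVneq (1 - ka) 0.
    have r0 : r = 0 by apply/eqP; rewrite -sqrf_eq0 rtr kE mulr0.
    by rewrite r0 mulr0 addr0 expr0n mulr0 addr0 addr_ge0 // mulr_ge0 ?sqr_ge0.
  have kp : 0 < 1 - ka by rewrite lt_neqAle eq_sym kN.
  have -> : al * X ^+ 2 + 2 * (2 * de * (cy * sy)) * X * r + de * S * r ^+ 2 + beta * rt =
    al * X ^+ 2 + 2 * (2 * de * (cy * sy)) * X * r + (de * S + beta / (1 - ka)) * r ^+ 2.
    by rewrite /rt; ring.
  apply: binary_form_ge0 => //.
    by rewrite addr_ge0 ?mulr_ge0 ?invr_ge0.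
  have -> : (2 * de * (cy * sy)) ^+ 2 = E.
    have -> : (2 * de * (cy * sy)) ^+ 2 = 4 * de ^+ 2 * (cy ^+ 2 * sy ^+ 2) by ring.
    by rewrite cyE syE /E; ring.
  by rewrite -(ler_pM2r kp) (le_trans L) // -[leRHS]mulrA (mulrDl (de * S)) divfK.
have -> : de * (2 * cy * X + sy * r) ^+ 2 = de * (4 * (1 - S) * X ^+ 2 + 4 * cy * sy * X * r + S * r ^+ 2).
  by rewrite -cyE -syE; ring.
have alE : al = 4 * de * (1 - S) + om by rewrite /al al1E al0E /om; ring.
by move: h1 h2 Uy; rewrite alE betaE /Th deQ; rewrite /om deQ; clear; lra.
Qed.

(* Same notation, in the regime [2x + 2y <= pi/2]: the antiparallel input to compare with is
   the one of squared length [U - h]. *)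
Lemma weak_coupling_bound (R : realFieldType) (sx cx sy cy t s S de U ka m r X h : R) :
  0 <= sx -> 0 < sy -> 0 <= cy ->
  sx ^+ 2 + cx ^+ 2 = 1 -> sy ^+ 2 + cy ^+ 2 = 1 -> sy <= sx -> sy <= cx -> sx <= cy ->
  t = sx * cy -> s = cx * sy -> S = sy ^+ 2 -> de = sx ^+ 2 - sy ^+ 2 ->
  0 <= ka -> ka <= U -> U <= 1 -> m ^+ 2 + r ^+ 2 <= (U - ka) ^+ 2 ->
  ka <= X ^+ 2 ->
  t * h = t * ka + s * m - s * U -> 0 < h ->
  [/\ h <= U,
    t * h * (2 * t + 2 * s * U + t * h) <= de * (2 * cy * X + sy * r) ^+ 2 +
      h * (2 * S - S ^+ 2 * (1 - U) - 2 * t * s - 2 * s ^+ 2 * U) + h ^+ 2 * (s ^+ 2 - S ^+ 2 / 2)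
  & (1 - U) ^+ 2 * (S + 2 * t * (t + s * U + t * h)) <=
    (1 - (U - h)) ^+ 2 * (S + 2 * t * (t + s * (U - h)))].
Proof.
move=> sx0 sy0' cy0 xE yE sysx sycx sxcy tE sE SE deE ka0 kaU U1 mr kX hE h0'.
have sy0 := ltW sy0'.
have cx0 := le_trans sy0 sycx.
have h0 := ltW h0'.
have U0 : 0 <= U := le_trans ka0 kaU.
have t0 : 0 <= t by rewrite tE mulr_ge0.
have S0 : 0 <= S by rewrite SE sqr_ge0.
have s0 : 0 < s by rewrite sE mulr_gt0 // (lt_le_trans sy0').
have Ss : S <= s by rewrite sE SE expr2 ler_wpM2r.
have cxcy : cx <= cy.
  rewrite -(@ler_pXn2r _ 2) ?nnegrE //.
  have : sy ^+ 2 <= sx ^+ 2 by rewrite ler_pXn2r // nnegrE.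
  by move: xE yE; clear; lra.
have st : s <= t by rewrite sE tE (mulrC sx) ler_pM.
have t0' : 0 < t := lt_le_trans s0 st.
have D0 : 0 <= t - s by rewrite subr_ge0.
have sx2 : sx ^+ 2 = 1 - cx ^+ 2 by rewrite -xE addrK.
have cy2 : cy ^+ 2 = 1 - S by rewrite SE -yE addrAC subrr add0r.
have cx2 : cx ^+ 2 = 1 - sx ^+ 2 by rewrite -xE addrAC subrr add0r.
have Tp : 0 <= sx ^+ 2 by exact: sqr_ge0.
have t2 : t ^+ 2 = sx ^+ 2 * (1 - S) by rewrite tE exprMn cy2.
have s2 : s ^+ 2 = S * (1 - sx ^+ 2) by rewrite sE exprMn cx2 SE mulrC.
have deQ : de = (t - s) * (t + s).
  have -> : (t - s) * (t + s) = t ^+ 2 - s ^+ 2 by ring.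
  by rewrite t2 s2 deE SE; ring.
have Uk : 0 <= U - ka by rewrite subr_ge0.
have mU : m <= U - ka.
  apply: le_trans (ler_norm m) _; rewrite -(@ler_pXn2r _ 2) ?nnegrE //.
  by rewrite real_normK ?num_real // (le_trans _ mr) // lerDl sqr_ge0.
have r3 : r ^+ 2 <= 2 * (U - ka - m) * (1 - ka).
  have h1 : 0 <= (U - ka - m) * (1 - U) by rewrite mulr_ge0 ?subr_ge0.
  have h2 : 0 <= (U - ka - m) ^+ 2 by exact: sqr_ge0.
  by move: mr h1 h2; clear; lra.
have k1 : 0 <= 1 - ka by rewrite subr_ge0 (le_trans kaU).
have hk : t * h <= (t - s) * ka.
  have h1 : 0 <= s * (U - ka - m) by rewrite mulr_ge0 ?(ltW s0) // subr_ge0.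
  by rewrite hE; move: h1; clear; lra.
have hka : h <= ka.
  rewrite -(ler_pM2l t0') (le_trans hk) // ler_wpM2r // lerBlDr lerDl ltW //.
have hU := le_trans hka kaU.
have [D1|Dn] := eqVneq (t - s) 0.
  by have := mulr_gt0 t0' h0'; rewrite ltNge (le_trans hk) // D1 mul0r.
have Dp : 0 < t - s by rewrite lt_neqAle eq_sym Dn.
have tsp : 0 <= t * s by rewrite mulr_ge0 // ltW.
have ss : s ^+ 2 <= t * s by rewrite expr2 ler_wpM2r // ltW.
have SSs : S ^+ 2 <= s ^+ 2 by rewrite ler_pXn2r // nnegrE // ltW.
split => //; last first.
  pose K : R := S + 2 * t ^+ 2 + 2 * (t * s) * U.
  have -> : S + 2 * t * (t + s * U + t * h) = K + 2 * t ^+ 2 * h by rewrite /K; ring.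
  have -> : S + 2 * t * (t + s * (U - h)) = K - 2 * (t * s) * h by rewrite /K; ring.
  have c1 : 0 <= (t * s) * (U - h) by rewrite mulr_ge0 // subr_ge0.
  have c2 := sqr_ge0 t.
  have c3 : t * s <= t ^+ 2 by rewrite expr2 ler_wpM2l.
  have K1 : 0 <= K - 2 * (t * s) * h by move: c1 c2 S0; rewrite /K; clear; lra.
  (* The factor [1 + 2 * h] is affordable because [(1 - U)^2 (1 + 2 h) <= (1 - U + h)^2]. *)
  have K2 : K + 2 * t ^+ 2 * h <= (1 + 2 * h) * (K - 2 * (t * s) * h).
    have : 0 <= h * (S + (t ^+ 2 - t * s) + 2 * ((t * s) * (U - h))).
      by rewrite mulr_ge0 //; move: S0 c1 c2 c3; clear; lra.
    by rewrite /K; clear; lra.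
  apply: le_trans (ler_wpM2l (sqr_ge0 _) K2) _.
  rewrite [leLHS]mulrA; apply: ler_wpM2r => //.
  have n0 : 0 <= 1 - U by rewrite subr_ge0.
  have : 0 <= h * (1 - U) * U by rewrite !mulr_ge0.
  have := sqr_ge0 h.
  have : 0 <= (1 - U) * U by rewrite mulr_ge0.
  by clear; lra.
(* After division by [h], [Ph] bounds from above the deficit in e2 that the [k] term must cover; it
   involves none of [U], [m] and [h]. *)
pose Ph : R := 2 * (t + s) ^+ 2 - 2 * S + t * (t - s) * ka.
have PhE : t * (2 * t + 2 * s * U + t * h) - (2 * S - S ^+ 2 * (1 - U) - 2 * t * s - 2 * s ^+ 2 * U)
   - h * (s ^+ 2 - S ^+ 2 / 2) <= Ph.
  have c1 : 0 <= (2 * (t * s) - S ^+ 2 + 2 * s ^+ 2) * (1 - U).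
    by rewrite mulr_ge0 ?subr_ge0 //; move: tsp SSs (sqr_ge0 s); clear; lra.
  have c2 : 0 <= h * (s ^+ 2 - S ^+ 2 / 2).
    by rewrite mulr_ge0 //; move: SSs (sqr_ge0 S); clear; lra.
  have c3 := ler_wpM2l t0 hk.
  by move: c1 c2 c3; rewrite /Ph; clear; lra.
have k2 : 0 <= de * (2 * cy * X + sy * r) ^+ 2.
  by rewrite mulr_ge0 ?sqr_ge0 // deQ mulr_ge0 // addr_ge0 // ltW.
suff : h * Ph <= de * (2 * cy * X + sy * r) ^+ 2.
  have := ler_wpM2l h0 PhE.
  clear; lra.
have [Ph0|Ph0] := leP Ph 0.
  by rewrite (le_trans _ k2) // mulr_ge0_le0.
have Ph0' := ltW Ph0.
pose A' : R := 4 * t * (t + s) * (1 - S) - Ph.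
have S12 : 0 <= 1 - 2 * S.
  have : sy ^+ 2 <= sx ^+ 2 by rewrite ler_pXn2r // nnegrE.
  have : sy ^+ 2 <= cx ^+ 2 by rewrite ler_pXn2r // nnegrE.
  by move: xE; rewrite SE; clear; lra.
have S1 : 0 <= 1 - S by move: S12 S0; clear; lra.
have Q0 : 0 <= t + s by rewrite addr_ge0 // ltW.
(* This is the discriminant condition of the form [h2] below: substituting
   [Ph = 4 t (t + s) (1 - S) - A'] makes that condition factor through [Ph], leaving something
   linear in [A']. The gap is affine in [ka], so its values at 0 and 1 are treated separately. *)
have A's : 2 * t * (t + s) * S * (t - s) * (1 - ka) <= A' * s.
  have c0 : 0 <= (1 - ka) * (2 * (sx * sy) * (cx * cy - sx * sy) * ((1 - S) * t - S * s)).
    rewrite !mulr_ge0 // subr_ge0; first by rewrite mulrC ler_pM.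
    by apply: ler_pM => //; [exact: ltW|move: S12; clear; lra].
  have c1 : 0 <= ka * s * ((1 - 4 * S) * (t ^+ 2 + t * s) + 2 * S * sx ^+ 2).
    rewrite mulr_ge0 //; first by rewrite mulr_ge0 // ltW.
    have [S4|S4] := leP 0 (1 - 4 * S).
      by rewrite addr_ge0 // mulr_ge0 // ?addr_ge0 ?sqr_ge0 // mulr_ge0.
    have : 0 <= (4 * S - 1) * (t ^+ 2 - t * s).
      by rewrite mulr_ge0 // ?subr_ge0 ?expr2 ?ler_wpM2l //; move: S4; clear; lra.
    have : 0 <= sx ^+ 2 * (1 - 2 * S) ^+ 2 by rewrite mulr_ge0 ?sqr_ge0.
    by rewrite t2; clear; lra.
  have -> : A' * s = 2 * t * (t + s) * S * (t - s) * (1 - ka) +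
     (1 - ka) * (2 * (sx * sy) * (cx * cy - sx * sy) * ((1 - S) * t - S * s)) +
     ka * s * ((1 - 4 * S) * (t ^+ 2 + t * s) + 2 * S * sx ^+ 2).
    have e0 : (4 * t * (t + s) * (1 - S) - 2 * (t + s) ^+ 2 + 2 * S) * s -
        2 * t * (t + s) * S * (t - s) =
        2 * (sx * sy) * (cx * cy - sx * sy) * ((1 - S) * t - S * s).
      apply/eqP; rewrite -subr_eq0; apply/eqP.
      (* The multipliers are the cofactors of the two Pythagorean relations in the polynomial
         identity [e0]; [lra] then only compares monomials. *)
      have := congr1 ( *%R (- 2 * cx * sy ^+ 3)) xE.
      have := congr1 ( *%R (- 2 * cx * sx ^+ 2 * sy ^+ 3 - 2 * cy * sx ^+ 3 * sy ^+ 2)) yE.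
      by rewrite tE sE SE; clear; lra.
    have e1 : 4 * t * (t + s) * (1 - S) - 2 * (t + s) ^+ 2 + 2 * S - t * (t - s) =
        (1 - 4 * S) * (t ^+ 2 + t * s) + 2 * S * sx ^+ 2.
      have -> : 2 * S * sx ^+ 2 = 2 * S - 2 * s ^+ 2 by rewrite s2; ring.
      ring.
    by rewrite -e0 -e1 /A' /Ph; ring.
  by rewrite -addrA lerDl addr_ge0.
have A'0 : 0 <= A'.
  by rewrite -(pmulr_lge0 _ s0) (le_trans _ A's) // !mulr_ge0.
pose rt : R := r ^+ 2 / (1 - ka).
have rtm : rt <= 2 * (U - ka - m).
  have [kE|kN] := eqVneq (1 - ka) 0.
    by rewrite /rt kE invr0 mulr0 mulr_ge0 // subr_ge0.
  have kp : 0 < 1 - ka by rewrite lt_neqAle eq_sym kN.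
  by rewrite /rt ler_pdivrMr.
have hE2 : t * h <= (t - s) * ka - s * rt / 2.
  have c : 0 <= s * (2 * (U - ka - m) - rt) by rewrite mulr_ge0 ?(ltW s0) // subr_ge0.
  by rewrite hE; move: c; clear; lra.
rewrite -(ler_pM2l t0').
apply: (@le_trans _ _ (Ph * ((t - s) * X ^+ 2 - s * rt / 2))).
  have c := ler_wpM2l Ph0' hE2.
  have c2 : 0 <= Ph * ((t - s) * (X ^+ 2 - ka)) by rewrite !mulr_ge0 // subr_ge0.
  by move: c c2; clear; lra.
have h2 : 0 <= A' * X ^+ 2 + 2 * (2 * t * (t + s) * (cy * sy)) * X * r + t * (t + s) * S * r ^+ 2
      + Ph * s / (2 * (t - s)) * rt.
  have [kE|kN] := eqVneq (1 - ka) 0.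
    have r0 : r = 0.
      apply/eqP; rewrite -sqrf_eq0 eq_le sqr_ge0 andbT.
      by rewrite (le_trans r3) // kE mulr0.
    by rewrite /rt r0 expr0n /= !(mulr0, mul0r, addr0) mulr_ge0 ?sqr_ge0.
  have kp : 0 < 1 - ka by rewrite lt_neqAle eq_sym kN.
  have -> : A' * X ^+ 2 + 2 * (2 * t * (t + s) * (cy * sy)) * X * r + t * (t + s) * S * r ^+ 2
      + Ph * s / (2 * (t - s)) * rt =
    A' * X ^+ 2 + 2 * (2 * t * (t + s) * (cy * sy)) * X * r +
     (t * (t + s) * S + Ph * s / (2 * (t - s) * (1 - ka))) * r ^+ 2.
    by rewrite /rt; field; rewrite kN Dn.
  have den0 : 0 < 2 * (t - s) * (1 - ka) by rewrite !mulr_gt0.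
  apply: binary_form_ge0 => //.
    by rewrite addr_ge0 ?divr_ge0 ?mulr_ge0 // ltW.
  have -> : (2 * t * (t + s) * (cy * sy)) ^+ 2 = 4 * t ^+ 2 * (t + s) ^+ 2 * S * (1 - S).
    have -> : (2 * t * (t + s) * (cy * sy)) ^+ 2 = 4 * t ^+ 2 * (t + s) ^+ 2 * (cy ^+ 2 * sy ^+ 2) by ring.
    by rewrite cy2 -SE; ring.
  rewrite -subr_ge0.
  have -> : A' * (t * (t + s) * S + Ph * s / (2 * (t - s) * (1 - ka))) -
     4 * t ^+ 2 * (t + s) ^+ 2 * S * (1 - S) =
     Ph / (2 * (t - s) * (1 - ka)) * (A' * s - 2 * t * (t + s) * S * (t - s) * (1 - ka)).
    have PhA : Ph = 4 * t * (t + s) * (1 - S) - A' by rewrite /A'; ring.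
    rewrite PhA; clear -kN Dn; field; by rewrite kN Dn.
  by rewrite mulr_ge0 ?subr_ge0 // divr_ge0 // ltW.
have -> : (2 * cy * X + sy * r) ^+ 2 = 4 * (1 - S) * X ^+ 2 + 4 * cy * sy * X * r + S * r ^+ 2.
  by rewrite -cy2 SE; ring.
rewrite -subr_ge0.
have -> : t * (de * (4 * (1 - S) * X ^+ 2 + 4 * cy * sy * X * r + S * r ^+ 2)) -
   Ph * ((t - s) * X ^+ 2 - s * rt / 2) = (t - s) *
   (A' * X ^+ 2 + 2 * (2 * t * (t + s) * (cy * sy)) * X * r + t * (t + s) * S * r ^+ 2
      + Ph * s / (2 * (t - s)) * rt).
  by rewrite deQ /A'; field.
by rewrite mulr_ge0.
Qed.

(** Cauchy-Schwarz for the plane vectors [(|a1|, sqrt P)] and [(|b1|, sqrt Q)]. It splits the budget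
    [U = |a||b|] between the first axis and the plane of the other two. *)
Lemma norm_add_sqrt_le (R : rcfType) (a1 b1 P Q : R) : 0 <= P -> 0 <= Q ->
  `|a1 * b1| + Num.sqrt (P * Q) <= Num.sqrt ((a1 ^+ 2 + P) * (b1 ^+ 2 + Q)).
Proof.
move=> P0 Q0.
have PQ : 0 <= P * Q by rewrite mulr_ge0.
have AB : 0 <= (a1 ^+ 2 + P) * (b1 ^+ 2 + Q) by rewrite mulr_ge0 ?addr_ge0 ?sqr_ge0.
rewrite -(@ler_pXn2r _ 2) ?nnegrE ?addr_ge0 ?sqrtr_ge0 //.
rewrite sqrrD !sqr_sqrtr // real_normK ?num_real //.
have -> : `|a1 * b1| * Num.sqrt (P * Q) = (`|a1| * Num.sqrt Q) * (`|b1| * Num.sqrt P).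
  by rewrite normrM sqrtrM //; ring.
have := sqr_ge0 (`|a1| * Num.sqrt Q - `|b1| * Num.sqrt P).
rewrite sqrrB !exprMn !sqr_sqrtr // !real_normK ?num_real // !mulr2n.
by move: (`|a1| * Num.sqrt Q * (`|b1| * Num.sqrt P)) => z; lra.
Qed.

(* The three bounds compare, up to positive factors, the elementary symmetric functions
   e4, e3, e2 of the output spectrum for Bloch vectors [a], [b] with those for
   [(0, 0, sqrt u)], [(0, 0, - sqrt u)]. *)
Lemma dominated_by_antiparallel (R : rcfType) (sx cx sy cy a1 a2 a3 b1 b2 b3 : R) :
  let t := sx * cy in let s := cx * sy in let S := sy ^+ 2 in
  let A := a1 ^+ 2 + a2 ^+ 2 + a3 ^+ 2 in let B := b1 ^+ 2 + b2 ^+ 2 + b3 ^+ 2 in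
  let q := (1 - A) * (1 - B) in
  let v := t * (1 - a1 * b1) - s * (a2 * b2 + a3 * b3) in
  let k := cy * (a1 - b1) + sy * (a2 * b3 - a3 * b2) in
  0 <= cx -> 0 <= cy -> 0 < sy -> sy <= sx ->
  sx ^+ 2 + cx ^+ 2 = 1 -> sy ^+ 2 + cy ^+ 2 = 1 -> A <= 1 -> B <= 1 ->
  exists u : R, [/\ 0 <= u <= 1, q <= (1 - u) ^+ 2,
    q * (S + 2 * t * v) <= (1 - u) ^+ 2 * (S + 2 * t * (t + s * u)) &
    - S ^+ 2 * q + 2 * S * (2 - A - B) + 2 * v ^+ 2 - 2 * (sx ^+ 2 - sy ^+ 2) * k ^+ 2
    <= - S ^+ 2 * (1 - u) ^+ 2 + 4 * S * (1 - u) + 2 * (t + s * u) ^+ 2].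
Proof.
move=> t s S A B q v k cx0 cy0 sy0' sysx xE yE A1 B1.
have sy0 := ltW sy0'.
have sx0 := le_trans sy0 sysx.
have t0 : 0 <= t by rewrite mulr_ge0.
have s0 : 0 <= s by rewrite mulr_ge0.
have S0 : 0 < S by rewrite exprn_gt0.
have S0' := ltW S0.
have xy2 : sy ^+ 2 <= sx ^+ 2 by rewrite ler_pXn2r // nnegrE.
have cxcy : cx <= cy.
  rewrite -(@ler_pXn2r _ 2) ?nnegrE //; by move: xE yE xy2; clear; lra.
have st : s <= t by rewrite /s /t (mulrC sx) ler_pM.
have cy2 : cy ^+ 2 = 1 - S by rewrite /S; move: yE; clear; lra.
have S1 : 0 <= 1 - S by rewrite -cy2 sqr_ge0.
have A0 : 0 <= A by rewrite !addr_ge0 ?sqr_ge0.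
have B0 : 0 <= B by rewrite !addr_ge0 ?sqr_ge0.
pose U : R := Num.sqrt (A * B).
have U0 : 0 <= U by rewrite sqrtr_ge0.
have U2 : U ^+ 2 = A * B by rewrite sqr_sqrtr // mulr_ge0.
have U1 : U <= 1.
  by rewrite -[1]sqrtr1 ler_wsqrtr // -[1]mulr1 ler_pM.
have AB2 : 2 * U <= A + B.
  have := sqr_ge0 (Num.sqrt A - Num.sqrt B).
  rewrite sqrrB !sqr_sqrtr // /U sqrtrM // mulr2n.
  by move: (Num.sqrt A * Num.sqrt B) => z; lra.
have qU : q <= (1 - U) ^+ 2 by rewrite /q; move: U2 AB2; clear; lra.
have q0 : 0 <= q by rewrite mulr_ge0 // subr_ge0.
pose m : R := - (a2 * b2 + a3 * b3).
pose r : R := a2 * b3 - a3 * b2.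
pose ka : R := - (a1 * b1).
pose rho : R := Num.sqrt ((a2 ^+ 2 + a3 ^+ 2) * (b2 ^+ 2 + b3 ^+ 2)).
have rho0 : 0 <= rho by rewrite sqrtr_ge0.
(* Lagrange's identity: dot and cross product in the plane of the second and third axes. *)
have rhoE : m ^+ 2 + r ^+ 2 = rho ^+ 2.
  rewrite sqr_sqrtr; last by rewrite mulr_ge0 ?addr_ge0 ?sqr_ge0.
  by rewrite /m /r; ring.
have kr : `|ka| + rho <= U.
  rewrite normrN /rho /U /A /B -!addrA.
  by apply: norm_add_sqrt_le; rewrite addr_ge0 ?sqr_ge0.
have mrho : `|m| <= rho.
  rewrite -(@ler_pXn2r _ 2) ?nnegrE // real_normK ?num_real // -rhoE.
  by rewrite lerDl sqr_ge0.
have vE : v = t * (1 + ka) + s * m by rewrite /v /ka /m; ring.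
pose X : R := (a1 - b1) / 2.
have kX : ka <= X ^+ 2.
  by have := sqr_ge0 (a1 + b1); rewrite /ka /X; clear; lra.
have kE : k = 2 * cy * X + sy * r by rewrite /k /X /r; field.
pose de : R := sx ^+ 2 - sy ^+ 2.
have de0 : 0 <= de by rewrite subr_ge0.
have km : `|ka| + `|m| <= U by apply: le_trans kr; rewrite lerD2l.
have tkm : t * ka + s * m <= t * U.
  apply: le_trans (ler_wpM2l t0 km); rewrite mulrDr lerD ?ler_wpM2l ?ler_norm //.
  apply: (@le_trans _ _ (s * `|m|)); first by rewrite ler_wpM2l ?ler_norm.
  by rewrite ler_wpM2r.
have tkm2 : - (t * U) <= t * ka + s * m.
  rewrite lerNl; apply: le_trans (ler_wpM2l t0 km); rewrite opprD mulrDr lerD //.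
    by rewrite -mulrN ler_wpM2l // -normrN ler_norm.
  apply: (@le_trans _ _ (s * `|m|)); first by rewrite -mulrN ler_wpM2l // -normrN ler_norm.
  by rewrite ler_wpM2r.
have tU : 0 <= t * (1 - U) by rewrite mulr_ge0 // subr_ge0.
have sU : 0 <= s * U by rewrite mulr_ge0.
have v0 : 0 <= v by rewrite vE; move: tkm2 tU; clear; lra.
(* Since [2 - A - B = 1 + q - U ^+ 2], the first two terms depend on [q], at fixed [U], with slope
   [2 * S - S ^+ 2 >= 0], and [q <= (1 - U) ^+ 2]. *)
have E2 : - S ^+ 2 * q + 2 * S * (2 - A - B) + 2 * v ^+ 2 - 2 * (sx ^+ 2 - sy ^+ 2) * k ^+ 2
   <= - S ^+ 2 * (1 - U) ^+ 2 + 4 * S * (1 - U) + 2 * v ^+ 2 - 2 * de * k ^+ 2.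
  have h : 0 <= (2 * S - S ^+ 2) * ((1 - U) ^+ 2 - q).
    rewrite mulr_ge0 ?subr_ge0 // expr2 ler_wpM2r //; move: S1; clear; lra.
  have U2S := congr1 ( *%R S) U2.
  by move: h U2S; rewrite -/de /q; clear; lra.
have dek : 0 <= de * k ^+ 2 by rewrite mulr_ge0 ?sqr_ge0.
(* The second and third axes contribute at most [s * U] to [v], so an excess must come from the
   first axis. *)
have kaP : t + s * U < v -> [/\ 0 <= ka, ka <= U & m ^+ 2 + r ^+ 2 <= (U - ka) ^+ 2].
  move=> vU.
  have [ka0|ka0] := leP 0 ka; last first.
    have h1 : t * ka <= 0 by rewrite mulr_ge0_le0 // ltW.
    have h2 : 0 <= s * (U - m).
      rewrite mulr_ge0 // subr_ge0 (le_trans (ler_norm m)) // (le_trans mrho) //.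
      by rewrite (le_trans _ kr) // lerDr.
    by exfalso; move: vU; rewrite vE; move: h1 h2; clear; lra.
  move: kr; rewrite ger0_norm // => kr.
  have kaU : ka <= U by rewrite (le_trans _ kr) // lerDl.
  split => //; rewrite rhoE ler_pXn2r ?nnegrE // ?subr_ge0 //.
  by move: kr; clear; lra.
have [cs|sc] := leP cx sy.
- exists 0.
  have q1 : q <= (1 - 0) ^+ 2.
    rewrite (le_trans qU) // subr0 expr1n expr_le1 ?subr_ge0 //; by move: U0; clear; lra.
  split => //; first by rewrite lexx ler01.
    apply: (@le_trans _ _ ((1 - U) ^+ 2 * (S + 2 * t * (t * (1 + U))))).
      apply: ler_pM => //; first by rewrite addr_ge0 // !mulr_ge0.
      by rewrite lerD2l ler_wpM2l ?mulr_ge0 //; rewrite vE; move: tkm; clear; lra.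
    have h1 : 0 <= U * (1 - U) * (1 + U) by rewrite !mulr_ge0 ?subr_ge0 ?addr_ge0.
    have h2 : 0 <= t ^+ 2 * (U * (1 - U) * (1 + U)) by rewrite mulr_ge0 ?sqr_ge0.
    have h3 : 0 <= S * (U * (2 - U)) by rewrite !mulr_ge0 //; move: U1; clear; lra.
    by move: h2 h3 (mulr_ge0 (sqr_ge0 t) (sqr_ge0 U)); clear; lra.
  apply: le_trans E2 _.
  pose mu : R := cx / sy.
  have sn0 : sy != 0 by rewrite gt_eqF.
  have mu0 : 0 <= mu by rewrite divr_ge0.
  have mu1 : mu <= 1 by rewrite ler_pdivrMr // mul1r.
  have sE : s = mu * S by rewrite /s /mu /S; field.
  have cx2 : mu ^+ 2 * S = 1 - sx ^+ 2.
    by rewrite -xE addrAC subrr add0r /mu /S; field.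
  have tE : t ^+ 2 = (1 - mu ^+ 2 * S) * (1 - S) by rewrite cx2 subKr -cy2 exprMn.
  have deE : de = 1 - S - mu ^+ 2 * S by rewrite cx2 /de /S; ring.
  have cI := @strong_coupling_bound R cy sy S mu t s de U _ _ _ _ _ S0 mu0 mu1 t0 sE cy2 erefl tE deE de0.
  have [vU|vU] := leP v (t + s * U).
    have z1 : 0 ^+ 2 + 0 ^+ 2 <= (U - 0) ^+ 2 by rewrite expr0n /= addr0 sqr_ge0.
    (* The quantity [y] does not depend on [ka], [m], [r] and [X], so zero values suffice to obtain
       its sign. *)
    have [y0 _] := cI 0 0 0 0 _ (lexx 0) U0 U1 z1 (sqr_ge0 0) erefl.
    have Uy := mulr_ge0 U0 y0.
    have v2 : v ^+ 2 <= (t + s * U) ^+ 2 by rewrite ler_pXn2r // nnegrE // addr_ge0.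
    by move: Uy v2 dek; clear; lra.
  have [ka0 kaU mr] := kaP vU.
  have [y0 H] := cI ka m r X _ ka0 kaU U1 mr kX erefl.
  have {}H := H ltac:(by move: vU; rewrite vE; clear; lra).
  by move: H; rewrite kE vE; clear; lra.
have sc' := ltW sc.
have sxcy : sx <= cy.
  rewrite -(@ler_pXn2r _ 2) ?nnegrE //.
  have : sy ^+ 2 <= cx ^+ 2 by rewrite ler_pXn2r // nnegrE.
  by move: xE yE; clear; lra.
have [vU|vU] := leP v (t + s * U).
  exists U; split => //; first by rewrite U0.
    apply: ler_pM => //; first by rewrite addr_ge0 // !mulr_ge0.
    by rewrite lerD2l ler_wpM2l // mulr_ge0.
  apply: le_trans E2 _.
  have v2 : v ^+ 2 <= (t + s * U) ^+ 2 by rewrite ler_pXn2r // nnegrE // addr_ge0.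
  by move: v2 dek; clear; lra.
have [ka0 kaU mr] := kaP vU.
have t0' : 0 < t by rewrite mulr_gt0 // (lt_le_trans sy0') // (le_trans sysx).
pose h : R := (v - t - s * U) / t.
have hE : t * h = t * ka + s * m - s * U.
  by rewrite /h mulrC divfK ?gt_eqF // vE; ring.
have h0 : 0 < h by rewrite divr_gt0 //; move: vU; clear; lra.
have [hU H1 H2] := @weak_coupling_bound R sx cx sy cy t s S de U ka m r X h sx0 sy0' cy0 xE yE sysx sc' sxcy
  erefl erefl erefl erefl ka0 kaU U1 mr kX hE h0.
have vE2 : v = t + s * U + t * h by rewrite hE vE; ring.
have uu : 0 <= U - h <= 1.
  by rewrite subr_ge0 hU /= (le_trans _ U1) // gerBl ltW.
exists (U - h); split => //.
- rewrite (le_trans qU) // ler_pXn2r ?nnegrE ?subr_ge0 //; first by move: h0; clear; lra.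
  by case/andP: uu.
- apply: le_trans H2; rewrite -vE2 ler_wpM2r //.
  by rewrite addr_ge0 // !mulr_ge0.
- apply: le_trans E2 _; move: H1; rewrite kE vE2; clear; lra.
Qed.

(** * Monotonicity of the entropy *)

Section EntropyMonotone.
Variable R : realType.

(* [-x ln x] is the integral over [t > 0] of [(ln (1 + t x) - x ln (1 + t)) / t^2];
   up to terms that only depend on the trace, [- slog x] is a primitive of the integrand. *)
Definition slog (x t : R) : R := (x + t^-1) * ln (1 + t * x).

Lemma is_derive_slog (x t : R) : 0 <= x -> 0 < t ->
  is_derive t (1 : R) (slog x) (x / t - ln (1 + t * x) / t ^+ 2).
Proof.
move=> x0 t0.
have tn0 : t != 0 by rewrite gt_eqF.
have p0 : 0 < 1 + t * x by rewrite ltr_pwDl // mulr_ge0 // ltW.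
have d1 : is_derive t (1 : R) (cst (1 : R) + (id : R -> R) * cst x) x.
  apply: is_derive_eq; rewrite /GRing.scale /= /cst /=; ring.
have d2 : is_derive t (1 : R) ((@ln R) \o (cst (1 : R) + (id : R -> R) * cst x)) (x / (1 + t * x)).
  have dl := is_derive1_ln p0.
  rewrite [x / _]mulrC.
  exact: (@is_derive1_comp R (@ln R) (cst (1 : R) + (id : R -> R) * cst x) t _ _ dl d1).
have d3 : is_derive t (1 : R) (cst x + (fun u : R => u^-1)) (- t ^- 2).
  have dV : is_derive t (1 : R) (fun u : R => u^-1) (- t ^- 2).
    apply: is_derive_eq; first exact: is_deriveV.
    by rewrite /GRing.scale /= mulr1.
  by apply: is_derive_eq; rewrite add0r.
have -> : slog x = (cst x + (fun u : R => u^-1)) * ((@ln R) \o (cst (1 : R) + (id : R -> R) * cst x)).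
  by apply/funext => u.
apply: is_derive_eq.
rewrite /GRing.scale /= /cst /=.
rewrite !fctE /=.
by field; rewrite tn0 gt_eqF.
Qed.

Lemma ln_prod1D (I : finType) (l : I -> R) (t : R) : (forall i, 0 <= l i) -> 0 < t ->
  ln (\prod_i (1 + t * l i)) = \sum_i ln (1 + t * l i).
Proof.
move=> l0 t0.
have [] : 0 < \prod_i (1 + t * l i) /\ ln (\prod_i (1 + t * l i)) = \sum_i ln (1 + t * l i).
  elim/big_rec2: _ => [|i y1 y2 _ [y10 IH]]; first by rewrite ln1.
  have p0 : 0 < 1 + t * l i by rewrite ltr_pwDl // mulr_ge0 // ltW.
  by rewrite mulr_gt0 //; split => //; rewrite lnM ?posrE // IH.
by [].
Qed.

Definition sumslog (I : finType) (l : I -> R) : R -> R := \sum_i slog (l i).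

Lemma is_derive_sumslog (I : finType) (l : I -> R) (t : R) :
  (forall i, 0 <= l i) -> 0 < t ->
  is_derive t (1 : R) (sumslog l) ((\sum_i l i) / t - ln (\prod_i (1 + t * l i)) / t ^+ 2).
Proof.
move=> l0 t0.
rewrite ln_prod1D // !mulr_suml -sumrB /sumslog.
elim/big_ind2: _ => [|f1 d1 f2 d2 h1 h2|i _]; first exact: is_derive_cst.
  exact: is_deriveD.
exact: is_derive_slog.
Qed.

Lemma sumslogE (I : finType) (l : I -> R) t : sumslog l t = \sum_i slog (l i) t.
Proof. by rewrite /sumslog fct_sumE. Qed.

(** With equal traces the terms in [1 / t] of the two derivatives cancel, and the difference has
    derivative [(ln (\prod_j (1 + t * m j)) - ln (\prod_i (1 + t * l i))) / t ^+ 2], which is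
    nonnegative. *)
Lemma sumslog_diff_le (I J : finType) (l : I -> R) (m : J -> R) (t0 t1 : R) :
  (forall i, 0 <= l i) -> (forall j, 0 <= m j) ->
  \sum_i l i = \sum_j m j ->
  (forall t : R, 0 < t -> \prod_i (1 + t * l i) <= \prod_j (1 + t * m j)) ->
  0 < t0 -> t0 <= t1 ->
  sumslog l t0 - sumslog m t0 <= sumslog l t1 - sumslog m t1.
Proof.
move=> l0 m0 lm le t00 t01.
pose G : R -> R := sumslog l - sumslog m.
pose dG (t : R) : R := (ln (\prod_j (1 + t * m j)) - ln (\prod_i (1 + t * l i))) / t ^+ 2.
have GE (t : R) : 0 < t -> is_derive t (1 : R) G (dG t).
  move=> tp.
  have d1 := is_derive_sumslog l0 tp; have d2 := is_derive_sumslog m0 tp.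
  apply: is_derive_eq; rewrite /dG lm; ring.
have [] := @MVT_segment R G dG t0 t1 t01.
- by move=> x; rewrite in_itv /= => /andP[h _]; apply: GE; apply: lt_trans h.
- apply: derivable_within_continuous => x; rewrite in_itv /= => /andP[h _].
  by have [] := GE x (lt_le_trans t00 h).
move=> c; rewrite in_itv /= => /andP[h _] E.
have cp := lt_le_trans t00 h.
have pp (K : finType) (k : K -> R) : (forall i, 0 <= k i) -> 0 < \prod_i (1 + c * k i).
  by move=> k0; apply: prodr_gt0 => i _; rewrite ltr_pwDl // mulr_ge0 // ltW.
rewrite -subr_ge0 -[X in 0 <= X](_ : G t1 - G t0 = _) //.
rewrite E mulr_ge0 ?subr_ge0 // divr_ge0 ?sqr_ge0 // subr_ge0.
by rewrite ler_ln ?posrE ?pp // le.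
Qed.

(** Boundary term at [t = 0]: [slog x t] tends to [x], so [sumslog] tends to the trace. *)
Lemma slog_bounds0 (x t : R) : 0 <= x -> 0 < t ->
  x <= slog x t <= x + t * x ^+ 2.
Proof.
move=> x0 t0.
have p0 : 0 < 1 + t * x by rewrite ltr_pwDl // mulr_ge0 // ltW.
have tx : 0 <= t * x by rewrite mulr_ge0 // ltW.
have slE : slog x t = (1 + t * x) * ln (1 + t * x) / t.
  by rewrite /slog; field; rewrite gt_eqF.
rewrite slE; apply/andP; split.
  rewrite ler_pdivlMr //.
  have := @le_ln1Dx R ((1 + t * x)^-1 - 1).
  rewrite addrCA subrr addr0 lnV ?posrE //.
  have vp : 0 < (1 + t * x)^-1 by rewrite invr_gt0.
  have v1 : -1 < (1 + t * x)^-1 - 1 by move: vp; clear; lra.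
  move=> /(_ v1) h.
  have := ler_wpM2l (ltW p0) h.
  rewrite mulrN mulrBr mulfV ?gt_eqF // mulr1; lra.
rewrite ler_pdivrMr //.
apply: (@le_trans _ _ ((1 + t * x) * (t * x))).
  by rewrite ler_wpM2l ?(ltW p0) // le_ln1Dx //; lra.
by rewrite le_eqVlt; apply/orP; left; apply/eqP; ring.
Qed.

(* [ln 0 = 0], so [x * ln x] vanishes at [0] *)
Lemma slog_bounds_oo (x t : R) : 0 <= x -> 0 < t ->
  x * ln x + x * ln t <= slog x t - ln (1 + t * x) / t <= x * ln x + x * ln t + t^-1.
Proof.
move=> x0 t0.
have -> : slog x t - ln (1 + t * x) / t = x * ln (1 + t * x).
  by rewrite /slog; field; rewrite gt_eqF.
have [->|xn0] := eqVneq x 0; first by rewrite !mul0r !add0r lexx invr_ge0 ltW.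
have xp : 0 < x by rewrite lt_neqAle eq_sym xn0.
have tx : 0 < t * x by rewrite mulr_gt0.
have p0 : 0 < 1 + t * x by rewrite addr_gt0.
rewrite -mulrDr -lnM ?posrE // (mulrC x t); apply/andP; split.
  by rewrite ler_wpM2l // ler_ln ?posrE // lerDr.
have -> : 1 + t * x = t * x * (1 + (t * x)^-1) by rewrite mulrDr mulr1 mulfV ?gt_eqF // addrC.
rewrite lnM ?posrE // ?addr_gt0 ?invr_gt0 // mulrDr lerD2l.
apply: (@le_trans _ _ (x * (t * x)^-1)).
  rewrite ler_wpM2l // le_ln1Dx //.
  have : 0 < (t * x)^-1 by rewrite invr_gt0.
  by lra.
by rewrite invfM mulrCA mulfV // mulr1.
Qed.

(** The improper integral is replaced by two endpoints: [sumslog l - sumslog m] is at least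
    [- e / 2] at [e / 2], does not decrease, and at a large [t1] is at most the entropy of [m] minus
    that of [l], up to another [e / 2]. *)
Lemma entropy_le_of_prod_le (I J : finType) (l : I -> R) (m : J -> R) :
  (forall i, 0 <= l i) -> (forall j, 0 <= m j) ->
  \sum_i l i = 1 -> \sum_j m j = 1 ->
  (forall t : R, 0 < t -> \prod_i (1 + t * l i) <= \prod_j (1 + t * m j)) ->
  - \sum_i l i * ln (l i) <= - \sum_j m j * ln (m j).
Proof.
move=> l0 m0 sl sm le.
have mS : \sum_j m j ^+ 2 <= 1.
  rewrite -sm; apply: ler_sum => j _; rewrite expr2 ler_piMr //.
  by rewrite -sm (bigD1 j) //= lerDl sumr_ge0.
suff H e : 0 < e -> - \sum_i l i * ln (l i) + \sum_j m j * ln (m j) <= e.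
  rewrite -subr_le0 opprK; apply/ler_addgt0Pr => e e0; rewrite add0r; exact: H.
move=> e0.
pose n : R := #|I|%:R + 1.
have n0 : 0 < n by rewrite ltr_wpDl.
have h0 : 0 < e / 2 by rewrite divr_gt0.
(* Large enough that the error [t1^-1] per eigenvalue of [l] totals at most [e / 2], and no smaller
   than the lower endpoint [e / 2]. *)
pose t1 : R := Num.max (e / 2) (n / (e / 2)).
have t10 : 0 < t1 by rewrite lt_max h0.
have t1n : #|I|%:R / t1 <= e / 2.
  rewrite ler_pdivrMr //.
  apply: (@le_trans _ _ (e / 2 * (n / (e / 2)))); last by rewrite ler_wpM2l ?(ltW h0) // le_max lexx orbT.
  by rewrite mulrCA mulfV ?gt_eqF // mulr1 /n lerDl.
have := @sumslog_diff_le _ _ l m (e / 2) t1 l0 m0 (etrans sl (esym sm)) le h0.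
rewrite le_max lexx => /(_ isT) H.
have lo : - (e / 2) <= sumslog l (e / 2) - sumslog m (e / 2).
  have a : 1 <= sumslog l (e / 2).
    rewrite sumslogE -[leLHS]sl; apply: ler_sum => i _.
    by have /andP[] := slog_bounds0 (l0 i) h0.
  have b : sumslog m (e / 2) <= 1 + e / 2.
    rewrite sumslogE; apply: (@le_trans _ _ (\sum_j (m j + e / 2 * m j ^+ 2))).
      apply: ler_sum => i _.
      by have /andP[] := slog_bounds0 (m0 i) h0.
    by rewrite big_split /= sm lerD2l -mulr_sumr ler_piMr // ltW.
  by move: a b; clear; lra.
have pp (K : finType) (k : K -> R) : (forall i, 0 <= k i) -> 0 < \prod_i (1 + t1 * k i).
  by move=> k0; apply: prodr_gt0 => i _; rewrite ltr_pwDl // mulr_ge0 // ltW.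
have lnle : (\sum_i ln (1 + t1 * l i)) / t1 <= (\sum_j ln (1 + t1 * m j)) / t1.
  by rewrite ler_wpM2r ?invr_ge0 ?(ltW t10) // -!ln_prod1D // ler_ln ?posrE ?pp // le.
have up1 : sumslog l t1 - (\sum_i ln (1 + t1 * l i)) / t1 <= \sum_i l i * ln (l i) + ln t1 + #|I|%:R / t1.
  rewrite sumslogE mulr_suml -sumrB.
  apply: (@le_trans _ _ (\sum_i (l i * ln (l i) + l i * ln t1 + t1^-1))).
    by apply: ler_sum => i _; have /andP[] := slog_bounds_oo (l0 i) t10.
  by rewrite !big_split /= -mulr_suml sl mul1r sumr_const mulr_natl cardE -cardE.
have lo1 : \sum_j m j * ln (m j) + ln t1 <= sumslog m t1 - (\sum_j ln (1 + t1 * m j)) / t1.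
  rewrite sumslogE mulr_suml -sumrB.
  apply: (@le_trans _ _ (\sum_j (m j * ln (m j) + m j * ln t1))).
    by rewrite big_split /= -mulr_suml sm mul1r.
  by apply: ler_sum => i _; have /andP[] := slog_bounds_oo (m0 i) t10.
move: H lo lnle up1 lo1 t1n.
move: (\sum_i ln _ ) => x1.
lra.
Qed.
End EntropyMonotone.

(** * Spectra of operators of rank at most four *)

(** Sylvester's determinant identity, from two triangular factorizations of the block matrix with
    rows [1, A] and [-B, 1]. *)
Lemma det1D_mulmxC (K : comNzRingType) (m n : nat) (A : 'M[K]_(m, n)) (B : 'M[K]_(n, m)) :
  \det (1%:M + A *m B) = \det (1%:M + B *m A).
Proof.
have e1 : block_mx (1%:M + A *m B) A 0 1%:M *m block_mx 1%:M 0 (- B) 1%:M =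
    block_mx 1%:M A (- B) 1%:M.
  rewrite mulmx_block !mulmx1 !mul0mx !mulmx0 !add0r !mul1mx mulmxN.
  by rewrite addrK.
have e2 : block_mx 1%:M 0 (- B) 1%:M *m block_mx 1%:M A 0 (1%:M + B *m A) =
    block_mx 1%:M A (- B) 1%:M.
  rewrite mulmx_block !mulmx1 !mul0mx !mulmx0 !mul1mx !addr0 mulNmx.
  by rewrite addrCA addNr addr0.
have := congr1 determinant (etrans e1 (esym e2)).
by rewrite !det_mulmx !det_ublock !det_lblock !det1 !(mul1r, mulr1).
Qed.

Section Spectrum.
Variable R : realType.
Local Notation C := R[i].
Variable I : finType.

Definition spectral_dec (rho : I -> I -> C) (V : I -> I -> C) (lam : I -> R) :=
  (forall k l, \sum_(m : I) conjc (V m k) * V m l = (k == l)%:R) /\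
  (forall p q, rho p q = \sum_(k : I) V p k * (lam k)%:C * conjc (V q k)).

Lemma conjC_conjc (z : C) : Num.conj z = conjc z.
Proof. by []. Qed.

Lemma sum_enum (F : I -> C) : \sum_(i < #|I|) F (enum_val i) = \sum_i F i.
Proof. by rewrite -(big_enum_val F). Qed.

Lemma spectral_dec_exists (rho : I -> I -> C) :
  (forall p q, rho p q = conjc (rho q p)) -> exists V lam, spectral_dec rho V lam.
Proof.
move=> herm.
pose A : 'M[C]_#|I| := \matrix_(i, j) rho (enum_val i) (enum_val j).
have Ah : A \is hermsymmx.
  apply/is_hermitianmxP; rewrite expr0 scale1r; apply/matrixP => i j; rewrite !mxE.
  exact: herm.
have /hermitian_normalmx /orthomx_spectralP AE := Ah.
have real := hermitian_spectral_diag_real Ah.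
have U := spectral_unitarymx A.
move: AE; rewrite (invmx_unitary U) => AE.
set P := spectralmx A in AE U; set D := spectral_diag A in AE real.
(* The library gives [A = P^* D P], so the eigenvectors are the conjugated rows of [P]. *)
exists (fun p k => conjc (P (enum_rank k) (enum_rank p))), (fun k => complex.Re (D ord0 (enum_rank k))).
split.
  move=> k l; have /unitarymxP/matrixP/(_ (enum_rank k) (enum_rank l)) := U.
  rewrite !mxE (inj_eq enum_rank_inj) => <-.
  rewrite -sum_enum; apply: eq_bigr => i _; rewrite !mxE enum_valK conjcK.
  by [].
move=> p q.
have -> : rho p q = A (enum_rank p) (enum_rank q) by rewrite mxE !enum_rankK.
rewrite {1}AE mxE -sum_enum; apply: eq_bigr => i _.
rewrite !mxE enum_valK conjcK; congr (_ * _).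
rewrite (bigD1 i) //= big1 ?addr0 => [|j ji]; last by rewrite !mxE (negbTE ji) mulr0.
rewrite !mxE eqxx mulr1n RRe_real //; exact: (mxOverP real).
Qed.

Section Decomposed.
Variables (rho V : I -> I -> C) (lam : I -> R).
Hypothesis dec : spectral_dec rho V lam.

(** Each eigenvalue is the value of the quadratic form of [rho] at its eigenvector, which is a sum
    of squared moduli when [rho] is a Gram sum. *)
Lemma spectral_dec_ge0 (J : finType) (X : J -> I -> C) :
  (forall p q, rho p q = \sum_j X j p * conjc (X j q)) -> forall k, 0 <= lam k.
Proof.
move=> rhoE k; have [orth rhoV] := dec.
have : (lam k)%:C = \sum_j `|\sum_p conjc (V p k) * X j p| ^+ 2.
  transitivity (\sum_p \sum_q conjc (V p k) * rho p q * V q k).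
    under eq_bigr => p _ do under eq_bigr => q _ do rewrite rhoV mulr_sumr mulr_suml.
    under eq_bigr => p _ do rewrite exchange_big /=.
    rewrite exchange_big /= (bigD1 k) //= [X in _ = _ + X]big1 ?addr0 => [|l lk].
      transitivity (\sum_p \sum_q (conjc (V p k) * V p k) * ((lam k)%:C * (conjc (V q k) * V q k))).
        under eq_bigr => p _ do rewrite -mulr_sumr -mulr_sumr orth eqxx mulr1.
        by rewrite -mulr_suml orth eqxx mul1r.
      by apply: eq_bigr => p _; apply: eq_bigr => q _; ring.
    transitivity (\sum_p \sum_q (conjc (V p k) * V p l) * ((lam l)%:C * (conjc (V q l) * V q k))).
      by apply: eq_bigr => p _; apply: eq_bigr => q _; ring.
    under eq_bigr => p _ do rewrite -mulr_sumr -mulr_sumr orth (negbTE lk) mulr0 mulr0.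
    by rewrite big1.
  under eq_bigr => p _ do under eq_bigr => q _ do rewrite rhoE mulr_sumr mulr_suml.
  under eq_bigr => p _ do rewrite exchange_big /=.
  rewrite exchange_big /=; apply: eq_bigr => j _.
  rewrite normCK mulr_suml; apply: eq_bigr => p _.
  rewrite conjC_conjc rmorph_sum /= mulr_sumr; apply: eq_bigr => q _.
  by rewrite rmorphM /= conjcK; ring.
move=> lE; rewrite -ler0c lE; apply: sumr_ge0 => j _.
by rewrite exprn_ge0.
Qed.

Variables (Psi : I -> 'I_4 -> C) (Y : 'I_4 -> 'I_4 -> C).
Hypothesis rhoPsi : forall p q, rho p q = \sum_l \sum_l' Psi p l * Y l l' * conjc (Psi q l').
Let Ym : 'M[C]_4 := \matrix_(l, l') Y l l'.
Let Gm : 'M[C]_4 := \matrix_(l, l') \sum_p conjc (Psi p l) * Psi p l'.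
Let n := #|I|.
Let Vm : 'M[C]_n := \matrix_(i, k) V (enum_val i) (enum_val k).
Let Vs : 'M[C]_n := \matrix_(k, i) conjc (V (enum_val i) (enum_val k)).
Let L : 'rV[C]_n := \row_k (lam (enum_val k))%:C.
Let Pm : 'M[C]_(n, 4) := \matrix_(i, l) Psi (enum_val i) l.
Let Ps : 'M[C]_(4, n) := \matrix_(l, i) conjc (Psi (enum_val i) l).

Let VsV : Vs *m Vm = 1%:M.
Proof.
apply/matrixP => k l; rewrite !mxE.
under eq_bigr => j _ do rewrite !mxE.
rewrite (sum_enum (fun p => conjc (V p (enum_val k)) * V p (enum_val l))).
by rewrite dec.1 (inj_eq enum_val_inj).
Qed.

Let rhoE : Pm *m Ym *m Ps = Vm *m diag_mx L *m Vs.
Proof.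
apply/matrixP => i j; transitivity (rho (enum_val i) (enum_val j)).
  rewrite rhoPsi mxE exchange_big /=; apply: eq_bigr => l' _.
  by rewrite !mxE mulr_suml; apply: eq_bigr => l _; rewrite !mxE.
rewrite dec.2 mxE -sum_enum; apply: eq_bigr => k _.
by rewrite mul_mx_diag !mxE.
Qed.

Let PsP : Ps *m Pm = Gm.
Proof.
apply/matrixP => l l'; rewrite !mxE -sum_enum; apply: eq_bigr => i _; by rewrite !mxE.
Qed.

(** [rho] has the form Psi Y Psi^*, so Sylvester's identity moves Psi to the other side and only the
    4x4 Gram matrix of its columns remains, whatever the size of [I]. *)
Lemma prod_spectral_dec (t : R) :
  (\prod_k (1 + t * lam k))%:C = \det (1%:M + t%:C *: (Ym *m Gm)).
Proof.
have -> : t%:C *: (Ym *m Gm) = (t%:C *: (Ym *m Ps)) *m Pm.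
  by rewrite -scalemxAl -mulmxA PsP.
rewrite -det1D_mulmxC -scalemxAr mulmxA rhoE.
have VVs : Vm *m Vs = 1%:M by exact: mulmx1C.
have -> : 1%:M + t%:C *: (Vm *m diag_mx L *m Vs) =
    Vm *m diag_mx (\row_k (1 + t * lam (enum_val k))%:C) *m Vs.
  have -> : diag_mx (\row_k (1 + t * lam (enum_val k))%:C) = 1%:M + t%:C *: diag_mx L.
    apply/matrixP => i j; rewrite !mxE; case: (i == j); last by rewrite !mulr0n mulr0 addr0.
    by rewrite !mulr1n rmorphD rmorphM rmorph1.
  by rewrite mulmxDr mulmxDl mulmx1 VVs -scalemxAr -scalemxAl.
rewrite !det_mulmx mulrAC -det_mulmx VVs det1 mul1r det_diag.
rewrite rmorph_prod /= (big_enum_val (fun k => (1 + t * lam k)%:C)).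
by apply: eq_bigr => k _; rewrite mxE.
Qed.

Lemma sum_spectral_dec : (\sum_k lam k)%:C = \tr (Ym *m Gm).
Proof.
rewrite -PsP mulmxA mxtrace_mulC mulmxA rhoE mxtrace_mulC mulmxA VsV mul1mx mxtrace_diag.
rewrite rmorph_sum /= -sum_enum.
by apply: eq_bigr => k _; rewrite mxE.
Qed.
End Decomposed.

(** [xget] returns the value of some decomposition; that decomposition is exposed here so that its
    trace and [\prod_k (1 + t * lam k)] can be computed. *)
Lemma vN_entropy_dec (rho : I -> I -> C) :
  (forall p q, rho p q = conjc (rho q p)) ->
  exists V lam, spectral_dec rho V lam /\
    vN_entropy rho = - \sum_k lam k * log2 (lam k).
Proof.
move=> herm; have [V [lam [dec1 dec2]]] := spectral_dec_exists herm.
rewrite /vN_entropy; case: xgetP => [s _ [V' [lam' [d1 [d2 ->]]]]|].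
  by exists V', lam'; split.
move=> /(_ (- \sum_k lam k * log2 (lam k))) []; exists V, lam; by split.
Qed.
End Spectrum.

(** * Explicit 4x4 determinants and characteristic polynomials *)

Section Det4.
Variable K : comNzRingType.

(** The minor on rows [i, j] and columns [k, l]. Entries are indexed by [nat] so that concrete ones
    reduce by computation before [ring] or [field] is called. *)
Definition det2f (F : nat -> nat -> K) (i j k l : nat) := F i k * F j l - F i l * F j k.
Definition det3f (F : nat -> nat -> K) (i j k : nat) :=
  F i i * det2f F j k j k - F i j * det2f F j k i k + F i k * det2f F j k i j.
Definition det4f (F : nat -> nat -> K) :=
  F 0%N 0%N * (F 1%N 1%N * det2f F 2 3 2 3 - F 1%N 2%N * det2f F 2 3 1 3 + F 1%N 3%N * det2f F 2 3 1 2)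
  - F 0%N 1%N * (F 1%N 0%N * det2f F 2 3 2 3 - F 1%N 2%N * det2f F 2 3 0 3 + F 1%N 3%N * det2f F 2 3 0 2)
  + F 0%N 2%N * (F 1%N 0%N * det2f F 2 3 1 3 - F 1%N 1%N * det2f F 2 3 0 3 + F 1%N 3%N * det2f F 2 3 0 1)
  - F 0%N 3%N * (F 1%N 0%N * det2f F 2 3 1 2 - F 1%N 1%N * det2f F 2 3 0 2 + F 1%N 2%N * det2f F 2 3 0 1).

Lemma det4E (F : nat -> nat -> K) : \det (\matrix_(i < 4, j < 4) F i j) = det4f F.
Proof.
rewrite (expand_det_row _ ord0) !big_ord_recl big_ord0 /cofactor !mxE /=.
rewrite !(expand_det_row _ ord0) !big_ord_recl !big_ord0 /cofactor !mxE /=.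
rewrite !(expand_det_row _ ord0) !big_ord_recl !big_ord0 /cofactor !mxE /=.
rewrite !det_mx11 !mxE /= /bump /= /det4f /det2f.
rewrite ?(addn0, add0n, addnS, addSn, exprS, expr0).
ring.
Qed.

(** The coefficients are the sums of principal minors, that is, the elementary symmetric functions
    of the spectrum. *)
Lemma det4_1D (F : nat -> nat -> K) (t : K) :
  \det (1%:M + t *: \matrix_(i < 4, j < 4) F i j) =
  1 + t * (F 0%N 0%N + F 1%N 1%N + F 2%N 2%N + F 3%N 3%N)
  + t ^+ 2 * (det2f F 0%N 1%N 0 1 + det2f F 0%N 2%N 0 2 + det2f F 0%N 3%N 0 3 +
              det2f F 1%N 2%N 1 2 + det2f F 1%N 3%N 1 3 + det2f F 2 3 2 3)
  + t ^+ 3 * (det3f F 0%N 1%N 2 + det3f F 0%N 1%N 3 + det3f F 0%N 2%N 3 + det3f F 1%N 2%N 3)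
  + t ^+ 4 * \det (\matrix_(i < 4, j < 4) F i j).
Proof.
have -> : 1%:M + t *: \matrix_(i < 4, j < 4) F i j =
    \matrix_(i < 4, j < 4) ((if i == j :> nat then 1 else 0) + t * F i j).
  by apply/matrixP => i j; rewrite !mxE -val_eqE; case: eqP.
rewrite (det4E (fun i j => (if i == j then 1 else 0) + t * F i j)) det4E /det4f /det3f /det2f /=.
ring.
Qed.
End Det4.

(* [coreY] and [coreB] are, up to a scalar, the Gram data of the output state in the operator
   basis [oper] below, in which [Z = a3 - i a2], [W = b3 - i b2], [f = exp (2 i x)] and
   [g = exp (2 i y)].  Working with units [f], [g] rather than with sines and cosines makes
   the identities free of side relations. *)
Section Core.
Variable K : numFieldType.
Variables (a1 b1 Z Zb W Wb f g : K).
Let F := f^-1.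
Let c := (g + g^-1) / 2.
Let h := (g - g^-1) / 2.
Let P := 1 + a1. Let M := 1 - a1. Let Q := 1 + b1. Let N := 1 - b1.

Definition coreY (i j : nat) : K :=
  match i, j with
  | 0, 0 => P + c ^+ 2 * M | 0, 1 => - (c * h * Z) | 0, 2 => - (f * h * Zb) | 0, 3 => c * (f * P + F * M)
  | 1, 0 => c * h * Zb     | 1, 1 => - (h ^+ 2 * P) | 1, 3 => F * h * Zb
  | 2, 0 => F * h * Z      | 2, 2 => - (h ^+ 2 * M) | 2, 3 => c * h * Z
  | 3, 0 => c * (F * P + f * M) | 3, 1 => - (f * h * Z) | 3, 2 => - (c * h * Zb) | 3, 3 => c ^+ 2 * P + M
  | _, _ => 0
  end.
Definition coreB (i j : nat) : K :=
  match i, j with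
  | 0, 0 => Q | 0, 1 => W | 1, 0 => Wb | 1, 1 => N
  | 2, 2 => Q | 2, 3 => W | 3, 2 => Wb | 3, 3 => N
  | _, _ => 0
  end.
Definition coreYB (i j : nat) : K :=
  coreY i 0 * coreB 0 j + coreY i 1 * coreB 1 j + coreY i 2 * coreB 2 j + coreY i 3 * coreB 3 j.

Let al := 1 - a1 ^+ 2 - Z * Zb.
Let be := 1 - b1 ^+ 2 - W * Wb.
Let cx := (f + f^-1) / 2.
Let jx := (f - f^-1) / 2.
Let v := jx * c * (1 - a1 * b1) - cx * h * ((Z * Wb + Zb * W) / 2).
Let k := c * (a1 - b1) - h * ((Zb * W - Z * Wb) / 2).

Hypotheses (f0 : f != 0) (g0 : g != 0).

Lemma core_e1 : coreYB 0 0 + coreYB 1 1 + coreYB 2 2 + coreYB 3 3 = 4.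
Proof. rewrite /coreYB /= /P /Q /M /N /c /h /F; field. by rewrite f0 g0. Qed.

Lemma core_e2 :
  det2f coreYB 0 1 0 1 + det2f coreYB 0 2 0 2 + det2f coreYB 0 3 0 3 +
  det2f coreYB 1 2 1 2 + det2f coreYB 1 3 1 3 + det2f coreYB 2 3 2 3 =
  2 * (- h ^+ 4 * (al * be) - 2 * h ^+ 2 * (al + be) - 2 * v ^+ 2 + 2 * (jx ^+ 2 - h ^+ 2) * k ^+ 2).
Proof.
rewrite /det2f /coreYB /= /v /k /al /be /jx /cx /P /Q /M /N /c /h /F; field. by rewrite f0 g0.
Qed.

Lemma core_e3 :
  det3f coreYB 0 1 2 + det3f coreYB 0 1 3 + det3f coreYB 0 2 3 + det3f coreYB 1 2 3 =
  4 * h ^+ 2 * (al * be) * (h ^+ 2 + 2 * jx * c * v).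
Proof.
rewrite /det3f /det2f /coreYB /= /v /al /be /jx /cx /P /Q /M /N /c /h /F; field. by rewrite f0 g0.
Qed.

Lemma core_e4 :
  det4f coreYB = h ^+ 4 * (h ^+ 4 - 4 * (jx * c) ^+ 2) * (al * be) ^+ 2.
Proof.
(* Multiplicativity of the determinant separates the two inputs, so denominators are cleared for
   [coreY] alone. *)
have -> : det4f coreYB = det4f coreY * det4f coreB.
  by rewrite /det4f /det2f /coreYB; ring.
have -> : det4f coreB = be ^+ 2 by rewrite /det4f /det2f /= /be /Q /N; ring.
have -> : det4f coreY = h ^+ 4 * (h ^+ 4 - 4 * (jx * c) ^+ 2) * al ^+ 2.
  rewrite /det4f /det2f /= /al /jx /P /M /c /h /F; field. by rewrite f0 g0.
ring.
Qed.
End Core.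

(** * The output spectrum *)

Section Reduction.
Variable R : realType.
Local Notation C := R[i].

(* The four products |r><s| of the eigenvectors of sigma_1 (times 2), in the order
   ++, +-, -+, --. *)
Definition oper (k i j : nat) : C :=
  match k with
  | 0 => 1
  | 1 => if j == 0%N then 1 else -1
  | 2 => if i == 0%N then 1 else -1
  | _ => if i == j then 1 else -1
  end.

Lemma conjc_oper k i j : conjc (oper k i j) = oper k i j.
Proof.
have c1 : conjc (-1 : C) = -1 by rewrite rmorphN rmorph1.
have c0 : conjc (1 : C) = 1 by rewrite rmorph1.
by case: k => [|[|[|k]]]; rewrite /oper; try case: ifP => _; (exact: c0 || exact: c1).
Qed.

Definition oper_state (a : nat) (phi : 'I_2 -> 'I_a -> C) (k : nat) (i : 'I_2) (r : 'I_a) : C :=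
  \sum_(i' < 2) oper k i i' * phi i' r.

Definition dens (a : nat) (phi : 'I_2 -> 'I_a -> C) (i j : 'I_2) : C :=
  \sum_(r < a) phi i r * conjc (phi j r).

Definition gram (a : nat) (phi : 'I_2 -> 'I_a -> C) (k k' : nat) : C :=
  \sum_(i < 2) \sum_(r < a) oper_state phi k i r * conjc (oper_state phi k' i r).

Lemma gramE a (phi : 'I_2 -> 'I_a -> C) k k' :
  gram phi k k' = \sum_(i < 2) \sum_(i1 < 2) \sum_(i2 < 2)
    oper k i i1 * oper k' i i2 * dens phi i1 i2.
Proof.
apply: eq_bigr => i _.
transitivity (\sum_(r < a) \sum_(i1 < 2) \sum_(i2 < 2)
    oper k i i1 * oper k' i i2 * (phi i1 r * conjc (phi i2 r))).
  apply: eq_bigr => r _; rewrite /oper_state mulr_suml; apply: eq_bigr => i1 _.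
  rewrite rmorph_sum mulr_sumr; apply: eq_bigr => i2 _.
  by rewrite rmorphM /= conjc_oper; ring.
rewrite exchange_big /=; apply: eq_bigr => i1 _.
rewrite exchange_big /=; apply: eq_bigr => i2 _.
by rewrite /dens mulr_sumr.
Qed.

Definition bloch1 a (phi : 'I_2 -> 'I_a -> C) : R := complex.Re (dens phi ord0 ord_max) * 2.
Definition bloch2 a (phi : 'I_2 -> 'I_a -> C) : R := - complex.Im (dens phi ord0 ord_max) * 2.
Definition bloch3 a (phi : 'I_2 -> 'I_a -> C) : R := complex.Re (dens phi ord0 ord0) - complex.Re (dens phi ord_max ord_max).

Lemma densC a (phi : 'I_2 -> 'I_a -> C) i j : dens phi i j = conjc (dens phi j i).
Proof.
rewrite /dens rmorph_sum; apply: eq_bigr => r _.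
by rewrite /= rmorphM /= conjcK mulrC.
Qed.

Lemma dens_real a (phi : 'I_2 -> 'I_a -> C) i : dens phi i i = (complex.Re (dens phi i i))%:C.
Proof.
have := densC phi i i; case: (dens phi i i) => u v /= [/eqP].
rewrite -addr_eq0 -mulr2n mulrn_eq0 /= => /eqP ->.
by [].
Qed.

Section Unit.
Variables (a : nat) (phi : 'I_2 -> 'I_a -> C).
Hypothesis phi1 : unit_state phi.
Let a1 := bloch1 phi. Let a2 := bloch2 phi. Let a3 := bloch3 phi.

Lemma dens_trace : complex.Re (dens phi ord0 ord0) + complex.Re (dens phi ord_max ord_max) = 1.
Proof.
apply: (@complexI R); rewrite rmorphD /= -!dens_real rmorph1.
rewrite -phi1 !big_ord_recl big_ord0 addr0; congr (_ + _).
by apply: eq_bigr => r _; congr (phi _ _ * conjc (phi _ _)); apply: val_inj.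
Qed.

Lemma dens00 : dens phi ord0 ord0 = ((1 + a3) / 2)%:C.
Proof.
rewrite dens_real /a3 /bloch3; congr (_%:C).
have := dens_trace.
by move: (complex.Re (dens phi ord0 ord0)) (complex.Re (dens phi ord_max ord_max)) => u v; lra.
Qed.
Lemma dens11 : dens phi ord_max ord_max = ((1 - a3) / 2)%:C.
Proof.
rewrite dens_real /a3 /bloch3; congr (_%:C).
have := dens_trace.
by move: (complex.Re (dens phi ord0 ord0)) (complex.Re (dens phi ord_max ord_max)) => u v; lra.
Qed.
Lemma dens01 : dens phi ord0 ord_max = (a1%:C - 'i%C * a2%:C) / 2.
Proof.
rewrite /a1 /a2 /bloch1 /bloch2; case: (dens phi ord0 ord_max) => u v /=.
rewrite (complexE (u +i* v)) /= !rmorphM rmorphN rmorph_nat /=; field=> //.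
Qed.
Lemma dens10 : dens phi ord_max ord0 = (a1%:C + 'i%C * a2%:C) / 2.
Proof.
rewrite densC /a1 /a2 /bloch1 /bloch2; case: (dens phi ord0 ord_max) => u v /=.
rewrite (complexE (u +i* (- v))) /= !rmorphM !rmorphN rmorph_nat /=; field => //.
Qed.

(** The operators are [2 |r><s|], so the Gram entry is 4 times the overlap of the [r] labels times
    an entry of the density matrix in the eigenbasis of sigma_1: two identical diagonal blocks. *)
Lemma gram_core (k k' : 'I_4) :
  gram phi k k' = 2 * coreB a1%:C (a3%:C + 'i%C * a2%:C) (a3%:C - 'i%C * a2%:C) k k'.
Proof.
rewrite gramE !big_ord_recl !big_ord0 /=.
have -> : lift ord0 ord0 = ord_max :> 'I_2 by apply: val_inj.
rewrite dens00 dens11 dens01 dens10; move: a1 a2 a3 => x1 x2 x3.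
rewrite !rmorphM /= !fmorphV !rmorph_nat /= rmorphD rmorphB rmorph1 /=.
by case: k => [[|[|[|[|k]]]] //= _]; case: k' => [[|[|[|[|k']]]] //= _]; rewrite /oper /= /bump /=; field=> //.
Qed.

(** The determinant of the reduced density matrix is nonnegative: by Lagrange's identity, twice it
    is the sum [S] of squared 2x2 minors of the coefficient matrix. *)
Lemma bloch_le1 : a1 ^+ 2 + a2 ^+ 2 + a3 ^+ 2 <= 1.
Proof.
have key : dens phi ord0 ord_max * dens phi ord_max ord0 <= dens phi ord0 ord0 * dens phi ord_max ord_max.
  pose S := \sum_r \sum_r' `|phi ord0 r * phi ord_max r' - phi ord0 r' * phi ord_max r| ^+ 2.
  have S0 : 0 <= S by do 2!(apply: sumr_ge0 => ? _); rewrite exprn_ge0.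
  suff SE : S = 2 * (dens phi ord0 ord0 * dens phi ord_max ord_max - dens phi ord0 ord_max * dens phi ord_max ord0).
    by move: S0; rewrite SE pmulr_rge0 // subr_ge0.
  have T (x y z w : 'I_2) : dens phi x y * dens phi z w =
     \sum_r \sum_r' phi x r * conjc (phi y r) * (phi z r' * conjc (phi w r')).
    rewrite /dens mulr_suml; apply: eq_bigr => r _; by rewrite mulr_sumr.
  have T' (x y z w : 'I_2) : dens phi x y * dens phi z w =
     \sum_r \sum_r' phi x r' * conjc (phi y r') * (phi z r * conjc (phi w r)).
    by rewrite T exchange_big.
  rewrite mulrBr !mulr2n !mulrDl !mul1r.
  rewrite {1}T {1}T' {1}T {1}T' -!big_split /= -sumrB; apply: eq_bigr => r _.
  rewrite -!big_split /= -sumrB; apply: eq_bigr => r' _.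
  rewrite normCK conjC_conjc rmorphB !rmorphM /=; ring.
move: key; rewrite dens00 dens11 dens01 dens10; move: a1 a2 a3 => x1 x2 x3 key.
have : ((x1 ^+ 2 + x2 ^+ 2) / 4)%:C <= ((1 - x3 ^+ 2) / 4)%:C.
  rewrite (_ : ((x1 ^+ 2 + x2 ^+ 2) / 4)%:C = (x1%:C - 'i%C * x2%:C) / 2 * ((x1%:C + 'i%C * x2%:C) / 2)).
    rewrite (_ : ((1 - x3 ^+ 2) / 4) = (1 + x3) / 2 * ((1 - x3) / 2)); last by field => //.
    by rewrite [X in _ <= X]rmorphM.
  have i2 : 'i%C * 'i%C = -1 :> C by rewrite -expr2 sqr_i.
  rewrite rmorphM fmorphV rmorphD !rmorphXn rmorph_nat /=.
  have -> : (x1%:C - 'i%C * x2%:C) / 2 * ((x1%:C + 'i%C * x2%:C) / 2) =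
    (x1%:C ^+ 2 - ('i%C * 'i%C) * x2%:C ^+ 2) / 4 by field => //.
  by rewrite i2; field => //.
rewrite lecR; lra.
Qed.
End Unit.
End Reduction.

(** * The gate expanded in products of the operators [oper] *)

Section Gate.
Variable R : realType.
Local Notation C := R[i].
Variables x y : R.

Definition phase (u : R) : C := cos u +i* sin u.

Lemma phase_neq0 u : phase u != 0.
Proof.
apply/eqP => -[c0 s0]; have := cos2Dsin2 u.
by rewrite c0 s0 !expr0n /= addr0 => /esym/eqP; rewrite oner_eq0.
Qed.

Lemma conj_phase u : conjc (phase u) = (phase u)^-1.
Proof.
apply: (mulfI (phase_neq0 u)); rewrite mulfV ?phase_neq0 //.
rewrite /phase /=; apply/eqP; rewrite eq_complex /=; apply/andP; split; apply/eqP.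
  by rewrite -(cos2Dsin2 u); ring.
by ring.
Qed.

Lemma phaseD u w : phase (u + w) = phase u * phase w.
Proof.
apply/eqP; rewrite eq_complex /= cosD sinD; apply/andP; split; apply/eqP; ring.
Qed.

Let e := phase x.
Let g := phase (y + y).
Let c := (g + g^-1) / 2.
Let h := (g - g^-1) / 2.

Lemma half_addV u : (phase u + (phase u)^-1) / 2 = (cos u)%:C.
Proof.
apply: (mulIf (_ : 2 != 0)) => //; rewrite divfK // -conj_phase.
by apply/eqP; rewrite eq_complex /=; apply/andP; split; apply/eqP; ring.
Qed.

Lemma half_subV u : (phase u - (phase u)^-1) / 2 = 'i%C * (sin u)%:C.
Proof.
apply: (mulIf (_ : 2 != 0)) => //; rewrite divfK // -conj_phase.
by apply/eqP; rewrite eq_complex /=; apply/andP; split; apply/eqP; ring.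
Qed.

Lemma coefU_eq : [/\ coefU x y y 0 = (e + e^-1 * c) / 2, coefU x y y 1 = (e - e^-1 * c) / 2,
   coefU x y y 2 = e^-1 * h / 2 & coefU x y y 3 = e^-1 * h / 2].
Proof.
have c1 := congr1 ( *%R (cos x)) (cos2Dsin2 y).
have c2 := congr1 ( *%R (sin x)) (cos2Dsin2 y).
rewrite /c /h half_addV half_subV -conj_phase cosD sinD /e /phase.
split; apply: (mulIf (_ : 2 != 0)) => //; rewrite divfK //;
  apply/eqP; rewrite eq_complex /=; apply/andP; split; apply/eqP;
  lra.
Qed.

(** Four times the coefficients of the gate in the basis [oper k] (x) [oper l]. The hypothesis
    [y = z] enters here: [c2 = c3] cancels the entries (1, 1) and (2, 2), leaving only the exchange
    terms (1, 2) and (2, 1). *)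
Definition gcoef (k l : nat) : C :=
  match k, l with
  | 0, 0 => e | 3, 3 => e
  | 0, 3 => e^-1 * c | 3, 0 => e^-1 * c
  | 1, 2 => e^-1 * h | 2, 1 => e^-1 * h
  | _, _ => 0
  end.

Lemma UelE (i j i' j' : 'I_2) :
  Uel x y y i j i' j' = (\sum_(k < 4) \sum_(l < 4) gcoef k l * oper R k i i' * oper R l j j') / 4.
Proof.
have [c0E c1E c2E c3E] := coefU_eq.
rewrite /Uel !big_ord_recl !big_ord0 /=.
have -> : lift ord0 ord0 = 1 :> 'I_4 by apply: val_inj.
have -> : lift ord0 (lift ord0 ord0) = 2 :> 'I_4 by apply: val_inj.
have -> : lift ord0 (lift ord0 (lift ord0 ord0)) = 3 :> 'I_4 by apply: val_inj.
rewrite (_ : ord0 = 0 :> 'I_4) //.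
rewrite c0E c1E c2E c3E.
have i2 : 'i * 'i = -1 :> C by rewrite -expr2 sqrCi.
have m1 (X : C) : X * - 'i * - 'i = - X by rewrite -mulrA mulrNN i2 mulrN1.
have m2 (X : C) : X * - 'i * 'i = X by rewrite -mulrA mulNr i2 opprK mulr1.
have m3 (X : C) : X * 'i * - 'i = X by rewrite -mulrA mulrN i2 opprK mulr1.
have m4 (X : C) : X * 'i * 'i = - X by rewrite -mulrA i2 mulrN1.
rewrite /gcoef; move: (e) (e^-1 * c) (e^-1 * h) => e' c' h'.
case: i => [[|[|i]] //= ?]; case: j => [[|[|j]] //= ?];
case: i' => [[|[|i']] //= ?]; case: j' => [[|[|j']] //= ?]; rewrite /pauli /oper /= /bump /=; rewrite ?(m1, m2, m3, m4); field => //.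
Qed.

Lemma out_stateE a b (phi : 'I_2 -> 'I_a -> C) (psi : 'I_2 -> 'I_b -> C) i ra j rb :
  out_state x y y phi psi i ra j rb = (\sum_(l < 4) (\sum_(k < 4) gcoef k l * oper_state phi k i ra)
     * oper_state psi l j rb) / 4.
Proof.
rewrite /out_state /oper_state.
under eq_bigr => i' _ do under eq_bigr => j' _ do rewrite UelE.
rewrite !big_ord_recl !big_ord0 /=.
move: (gcoef) => G.
ring.
Qed.

Definition redY a (phi : 'I_2 -> 'I_a -> C) (l l' : nat) : C :=
  (\sum_(k < 4) \sum_(k' < 4) gcoef k l * conjc (gcoef k' l') * gram phi k k') / 16.

(** Tracing out A and its ancilla leaves a coefficient matrix [redY] that depends on [phi] only,
    between four vectors that depend on [psi] only; this is the shape required by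
    [prod_spectral_dec]. *)
Lemma reducedE a b (phi : 'I_2 -> 'I_a -> C) (psi : 'I_2 -> 'I_b -> C) (p q : 'I_2 * 'I_b) :
  reduced_BRB x y y phi psi p q = \sum_(l < 4) \sum_(l' < 4)
    oper_state psi l p.1 p.2 * redY phi l l' * conjc (oper_state psi l' q.1 q.2).
Proof.
rewrite /reduced_BRB.
transitivity (\sum_(i < 2) \sum_(ra < a) \sum_(l < 4) \sum_(l' < 4) \sum_(k < 4) \sum_(k' < 4)
  oper_state psi l p.1 p.2 * (gcoef k l * conjc (gcoef k' l') *
   (oper_state phi k i ra * conjc (oper_state phi k' i ra)) / 16) * conjc (oper_state psi l' q.1 q.2)).
  apply: eq_bigr => i _; apply: eq_bigr => ra _.
  have conj4 (z : C) : conjc (z / 4) = conjc z / 4 by rewrite rmorphM fmorphV rmorph_nat.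
  rewrite !out_stateE conj4.
  move: (oper_state phi) (oper_state psi) => Phi Psi; rewrite rmorph_sum /=.
  have -> (u w : C) : u / 4 * (w / 4) = u * w / 16 by field => //.
  rewrite big_distrlr mulr_suml; apply: eq_bigr => l _.
  rewrite mulr_suml; apply: eq_bigr => l' _.
  rewrite rmorphM /= rmorph_sum /=.
  have -> (u w u' w' : C) : u * w * (u' * w') / 16 = w * (u * u' / 16) * w' by field => //.
  rewrite big_distrlr /= !(mulr_suml, mulr_sumr); apply: eq_bigr => k _.
  rewrite !(mulr_suml, mulr_sumr); apply: eq_bigr => k' _.
  by rewrite rmorphM /=; field => //.
rewrite /redY /gram; move: (oper_state phi) (oper_state psi) => Phi Psi.
under eq_bigr => i _ do rewrite exchange_big /=.
rewrite exchange_big /=; apply: eq_bigr => l _.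
under eq_bigr => i _ do rewrite exchange_big /=.
rewrite exchange_big /=; apply: eq_bigr => l' _.
under eq_bigr => i _ do rewrite exchange_big /=.
rewrite exchange_big /= !(mulr_suml, mulr_sumr); apply: eq_bigr => k _.
under eq_bigr => i _ do rewrite exchange_big /=.
rewrite exchange_big /= !(mulr_suml, mulr_sumr); apply: eq_bigr => k' _.
rewrite !(mulr_suml, mulr_sumr); apply: eq_bigr => i _.
rewrite !(mulr_suml, mulr_sumr); apply: eq_bigr => ra _.
by ring.
Qed.
End Gate.

(** * The characteristic polynomial of the output in terms of the Bloch vectors *)

Lemma mxtrace4 (K : comNzRingType) (F : nat -> nat -> K) :
  \tr (\matrix_(i < 4, j < 4) F i j) = F 0%N 0%N + F 1%N 1%N + F 2%N 2%N + F 3%N 3%N.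
Proof. by rewrite /mxtrace !big_ord_recl big_ord0 !mxE addr0 !addrA. Qed.

(** Passes from the identities in units to real data: there [h] is [I * sy] and [jx] is [I * sx],
    hence the complex [v] is [I] times the real [V], while [k] is already real. The factor [4^-1] in
    [w] is the normalization of the core matrix, whose trace is 4. *)
Lemma charpoly_real (R : realType) (Sx Cx Sy Cy A1 A2 A3 B1 B2 B3 u : R) :
  let I : R[i] := 'i%C in
  let sx := Sx%:C in let cx := Cx%:C in let sy := Sy%:C in let cy := Cy%:C in
  let a1 := A1%:C in let a2 := A2%:C in let a3 := A3%:C in
  let b1 := B1%:C in let b2 := B2%:C in let b3 := B3%:C in
  let Z := a3 - I * a2 in let Zb := a3 + I * a2 in
  let W := b3 - I * b2 in let Wb := b3 + I * b2 in
  let al := 1 - a1 ^+ 2 - Z * Zb in let be := 1 - b1 ^+ 2 - W * Wb in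
  let v := I * sx * cy * (1 - a1 * b1) - cx * (I * sy) * ((Z * Wb + Zb * W) / 2) in
  let k := cy * (a1 - b1) - I * sy * ((Zb * W - Z * Wb) / 2) in
  let A := A1 ^+ 2 + A2 ^+ 2 + A3 ^+ 2 in let B := B1 ^+ 2 + B2 ^+ 2 + B3 ^+ 2 in
  let q := (1 - A) * (1 - B) in
  let V := Sx * Cy * (1 - A1 * B1) - Cx * Sy * (A2 * B2 + A3 * B3) in
  let K := Cy * (A1 - B1) + Sy * (A2 * B3 - A3 * B2) in
  let w := u%:C * 4^-1 in
  1 + w * 4 + w ^+ 2 * (2 * (- (I * sy) ^+ 4 * (al * be) - 2 * (I * sy) ^+ 2 * (al + be) - 2 * v ^+ 2 +
    2 * ((I * sx) ^+ 2 - (I * sy) ^+ 2) * k ^+ 2)) +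
  w ^+ 3 * (4 * (I * sy) ^+ 2 * (al * be) * ((I * sy) ^+ 2 + 2 * (I * sx) * cy * v)) +
  w ^+ 4 * ((I * sy) ^+ 4 * ((I * sy) ^+ 4 - 4 * (I * sx * cy) ^+ 2) * (al * be) ^+ 2) =
  (1 + u + u ^+ 2 * ((- (Sy ^+ 2) ^+ 2 * q + 2 * Sy ^+ 2 * (2 - A - B) + 2 * V ^+ 2
      - 2 * (Sx ^+ 2 - Sy ^+ 2) * K ^+ 2) / 8)
  + u ^+ 3 * (Sy ^+ 2 * (q * (Sy ^+ 2 + 2 * (Sx * Cy) * V)) / 16)
  + u ^+ 4 * ((Sy ^+ 2) ^+ 2 * ((Sy ^+ 2) ^+ 2 + 4 * (Sx * Cy) ^+ 2) / 256 * q ^+ 2))%:C.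
Proof.
move=> I sx cx sy cy a1 a2 a3 b1 b2 b3 Z Zb W Wb al be v k A B q V K w.
have i2 : I ^+ 2 = -1 by rewrite /I sqr_i.
have sqI (z : R[i]) : (I * z) ^+ 2 = - z ^+ 2 by rewrite exprMn i2 mulN1r.
have sqI4 (z : R[i]) : (I * z) ^+ 4 = z ^+ 4.
  by rewrite (_ : 4 = 2 * 2)%N // !exprM sqI sqrrN.
have ZZ (p r : R[i]) : (p - I * r) * (p + I * r) = p ^+ 2 + r ^+ 2.
  have -> : (p - I * r) * (p + I * r) = p ^+ 2 - I ^+ 2 * r ^+ 2 by ring.
  by rewrite i2; ring.
have ZWp : Z * Wb + Zb * W = 2 * (a2 * b2 + a3 * b3).
  have -> : Z * Wb + Zb * W = 2 * (a3 * b3 - I ^+ 2 * (a2 * b2)) by rewrite /Z /W /Zb /Wb; ring.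
  by rewrite i2; ring.
have ZWm : Zb * W - Z * Wb = 2 * I * (a2 * b3 - a3 * b2) by rewrite /Z /W /Zb /Wb; ring.
have vE : v = I * V%:C by rewrite /v ZWp /V; field => //.
have kE : k = K%:C.
  have -> : k = cy * (a1 - b1) - I ^+ 2 * (sy * (a2 * b3 - a3 * b2)) by rewrite /k ZWm; field => //.
  by rewrite i2 /K; ring.
have alE : al = (1 - A)%:C by rewrite /al /Z /Zb ZZ /A; ring.
have beE : be = (1 - B)%:C by rewrite /be /W /Wb ZZ /B; ring.
have -> : 2 * (I * sx) * cy * v = - (2 * (sx * cy) * V%:C).
  have -> : 2 * (I * sx) * cy * v = I ^+ 2 * (2 * (sx * cy) * V%:C) by rewrite vE; ring.
  by rewrite i2 mulN1r.
have -> : al * be = q%:C by rewrite alE beE /q; ring.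
have -> : al + be = (2 - A - B)%:C by rewrite alE beE; ring.
rewrite vE kE -(mulrA I sx cy) !sqI !sqI4 /w /sx /cy /sy.
clear; move: V K A B q => V K A B q.
by field => //.
Qed.

Section CharPoly.
Variable R : realType.
Local Notation C := R[i].
Variables x y : R.

Definition zbloch a (phi : 'I_2 -> 'I_a -> C) : C := (bloch3 phi)%:C - 'i%C * (bloch2 phi)%:C.
Definition zblochc a (phi : 'I_2 -> 'I_a -> C) : C := (bloch3 phi)%:C + 'i%C * (bloch2 phi)%:C.

(** The conjugate of [gcoef] with conjugation eliminated: a phase becomes its inverse and the purely
    imaginary [h] changes sign. The result is rational in the phases, so [field] applies. *)
Definition gcoefc (k l : nat) : C :=
  let e := phase x in let g := phase (y + y) in
  match k, l with
  | 0, 0 => e^-1 | 3, 3 => e^-1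
  | 0, 3 => e * ((g + g^-1) / 2) | 3, 0 => e * ((g + g^-1) / 2)
  | 1, 2 => - (e * ((g - g^-1) / 2)) | 2, 1 => - (e * ((g - g^-1) / 2))
  | _, _ => 0
  end.

Lemma conj_gcoef k l : conjc (gcoef x y k l) = gcoefc k l.
Proof.
have ce := conj_phase x.
have cM (u w : C) : conjc (u * w) = conjc u * conjc w by rewrite rmorphM.
have cV : conjc (phase x)^-1 = phase x by rewrite conjc_inv ce invrK.
have cc : conjc ((phase (y + y) + (phase (y + y))^-1) / 2) = (phase (y + y) + (phase (y + y))^-1) / 2.
  by rewrite half_addV conjc_real.
have ch : conjc ((phase (y + y) - (phase (y + y))^-1) / 2) = - ((phase (y + y) - (phase (y + y))^-1) / 2).
  rewrite half_subV cM conjc_real.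
  by apply/eqP; rewrite eq_complex /=; apply/andP; split; apply/eqP; ring.
have c0 : conjc (0 : C) = 0 by rewrite rmorph0.
rewrite /gcoef /gcoefc.
by case: k => [|[|[|[|k]]]]; case: l => [|[|[|[|l]]]]; cbv beta iota zeta;
  rewrite ?c0 1?cM ?ce ?cV ?cc ?ch ?mulrN.
Qed.

Lemma redY_core a (phi : 'I_2 -> 'I_a -> C) (l l' : 'I_4) : unit_state phi ->
  redY x y phi l l' = coreY (bloch1 phi)%:C (zbloch phi) (zblochc phi)
    (phase (x + x)) (phase (y + y)) l l' / 8.
Proof.
move=> phi1; rewrite /redY.
under eq_bigr => k _ do under eq_bigr => k' _ do rewrite gram_core // conj_gcoef.
rewrite -/(zbloch phi) -/(zblochc phi) phaseD.
rewrite !big_ord_recl !big_ord0.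
have e0 := phase_neq0 x; have g0 := phase_neq0 (y + y).
rewrite /gcoef /gcoefc.
move: (zbloch phi) (zblochc phi) ((bloch1 phi)%:C) (phase x) (phase (y + y)) e0 g0 => Z Zb A1 e g e0 g0.
by case: l => [[|[|[|[|l]]]] // ll]; case: l' => [[|[|[|[|l']]]] // ll'] /=; field; rewrite e0 g0.
Qed.

Section Spectrum.
Variables (a b : nat) (phi : 'I_2 -> 'I_a -> C) (psi : 'I_2 -> 'I_b -> C).
Hypotheses (phi1 : unit_state phi) (psi1 : unit_state psi).
Variables (V : 'I_2 * 'I_b -> 'I_2 * 'I_b -> C) (lam : 'I_2 * 'I_b -> R).
Hypothesis dec : spectral_dec (reduced_BRB x y y phi psi) V lam.

Lemma lam_ge0 k : 0 <= lam k.
Proof.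
apply: (spectral_dec_ge0 dec (X := fun (j : 'I_2 * 'I_a) p => out_state x y y phi psi j.1 j.2 p.1 p.2)).
by move=> p q; rewrite /reduced_BRB pair_bigA.
Qed.

Let YG : \matrix_(l, l') redY x y phi l l' *m
   (\matrix_(l < 4, l' < 4) \sum_(p : 'I_2 * 'I_b) conjc (oper_state psi l p.1 p.2) * oper_state psi l' p.1 p.2) =
   4^-1 *: \matrix_(l < 4, l' < 4) coreYB (bloch1 phi)%:C (bloch1 psi)%:C (zbloch phi) (zblochc phi)
    (zbloch psi) (zblochc psi) (phase (x + x)) (phase (y + y)) l l'.
Proof.
(* The conjugate sits on the other factor than in [gram], so the indices are exchanged; in [coreB]
   this swaps the two off-diagonal parameters. *)
have GE (l l' : 'I_4) : \sum_(p : 'I_2 * 'I_b) conjc (oper_state psi l p.1 p.2) * oper_state psi l' p.1 p.2 =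
    2 * coreB (bloch1 psi)%:C (zbloch psi) (zblochc psi) l l'.
  transitivity (gram psi l' l).
    rewrite /gram pair_bigA; apply: eq_bigr => p _; by rewrite mulrC.
  rewrite gram_core // -/(zbloch psi) -/(zblochc psi).
  by case: l => [[|[|[|[|l]]]] // ll]; case: l' => [[|[|[|[|l']]]] // ll'].
apply/matrixP => l l'; rewrite !mxE.
under eq_bigr => k _ do rewrite !mxE GE redY_core //.
rewrite /coreYB; move: (coreY _ _ _ _ _) (coreB _ _ _) => Y B.
by rewrite !big_ord_recl big_ord0 /= /bump /=; field => //.
Qed.

Lemma lam_sum : \sum_k lam k = 1.
Proof.
apply: (@complexI R); rewrite (sum_spectral_dec dec (reducedE x y phi psi)) YG.
rewrite mxtraceZ mxtrace4 core_e1 ?phase_neq0 //.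
by rewrite mulVf // rmorph1.
Qed.

Let sx := sin (x + x). Let cx := cos (x + x). Let sy := sin (y + y). Let cy := cos (y + y).
Let a1 := bloch1 phi. Let a2 := bloch2 phi. Let a3 := bloch3 phi.
Let b1 := bloch1 psi. Let b2 := bloch2 psi. Let b3 := bloch3 psi.
Let t := sx * cy. Let s := cx * sy. Let S := sy ^+ 2.
Let A := a1 ^+ 2 + a2 ^+ 2 + a3 ^+ 2. Let B := b1 ^+ 2 + b2 ^+ 2 + b3 ^+ 2.
Let q := (1 - A) * (1 - B).
Let v := t * (1 - a1 * b1) - s * (a2 * b2 + a3 * b3).
Let k := cy * (a1 - b1) + sy * (a2 * b3 - a3 * b2).

Lemma lam_prod (u : R) : \prod_k (1 + u * lam k) =
  1 + u + u ^+ 2 * ((- S ^+ 2 * q + 2 * S * (2 - A - B) + 2 * v ^+ 2 - 2 * (sx ^+ 2 - sy ^+ 2) * k ^+ 2) / 8)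
  + u ^+ 3 * (S * (q * (S + 2 * t * v)) / 16)
  + u ^+ 4 * (S ^+ 2 * (S ^+ 2 + 4 * t ^+ 2) / 256 * q ^+ 2).
Proof.
apply: (@complexI R); rewrite (prod_spectral_dec dec (reducedE x y phi psi)) YG scalerA det4_1D det4E.
rewrite core_e1 ?phase_neq0 // core_e2 ?phase_neq0 // core_e3 ?phase_neq0 // core_e4 ?phase_neq0 //.
rewrite !half_addV !half_subV /zbloch /zblochc -/sx -/cx -/sy -/cy -/a1 -/a2 -/a3 -/b1 -/b2 -/b3.
rewrite /q /v /k /A /B /t /s /S.
move: sx cx sy cy a1 a2 a3 b1 b2 b3 => sx' cx' sy' cy' a1' a2' a3' b1' b2' b3'.
exact: charpoly_real.
Qed.
End Spectrum.
End CharPoly.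

(** * The optimal input *)

Section XlnX.
Variable R : realType.

(** With [s = sqrt x], the bound [- ln s <= 1 / s] gives [- x ln x = - 2 s^2 ln s <= 2 s]. *)
Lemma xlnx_bound (x : R) : 0 < x -> x < 1 -> `|x * ln x| <= 2 * Num.sqrt x.
Proof.
move=> x0 x1.
rewrite ler0_norm; last by rewrite mulr_ge0_le0 ?(ltW x0) // ln_le0 // ltW.
have s0 : 0 < Num.sqrt x by rewrite sqrtr_gt0.
rewrite -{1 2}(sqr_sqrtr (ltW x0)); move: (Num.sqrt x) s0 => s s0.
have h : - ln s <= s^-1 by rewrite -lnV ?posrE // ltW // ln_sublinear // invr_gt0.
have := ler_wpM2l (sqr_ge0 s) h.
have -> : s ^+ 2 * s^-1 = s by field; rewrite gt_eqF.
by rewrite lnXn // mulr2n; move: (ln s) => b; lra.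
Qed.

(** Holds on the whole line because [ln] is 0 on nonpositive reals; [cand_entropy] is then
    continuous without sign conditions on its spectrum. *)
Lemma continuous_xlnx : continuous (fun x : R => x * ln x).
Proof.
move=> x; have [x0|x0|x0] := ltgtP x 0.
- have xz : x * ln x = 0 by rewrite ln0 ?mulr0 // ltW.
  rewrite /continuous_at xz.
  apply: cvg_near_cst; near=> z.
  rewrite ln0 ?mulr0 //; near: z.
  by apply: filterS (lt_nbhsl x0) => z /ltW.
- apply: (@continuousM _ _ (fun z : R => z) (@ln R)); first exact: cvg_id.
  exact: continuous_ln.
- rewrite x0 /continuous_at mul0r.
  apply/cvgrPdist_le => e e0; near=> z.
  rewrite sub0r normrN.
  have [z0|z0] := leP z 0; first by rewrite ln0 // mulr0 normr0 ltW.
  have z1 : z < 1 by near: z; apply: lt_nbhsl; exact: ltr01.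
  apply: le_trans (xlnx_bound z0 z1) _.
  have ze : z < (e / 2) ^+ 2.
    by near: z; apply: lt_nbhsl; rewrite exprn_gt0 // divr_gt0.
  have : Num.sqrt z <= e / 2.
    rewrite -(@ler_pXn2r _ 2) ?nnegrE ?sqrtr_ge0 // ?divr_ge0 ?(ltW e0) //.
    by rewrite sqr_sqrtr ltW.
  by lra.
Unshelve. all: by end_near. Qed.
End XlnX.

(** * Schmidt inputs, their explicit spectra, and attainment of the maximum *)

Section Final.
Variable R : realType.
Local Notation C := R[i].

Lemma schmidt2_dens (t : R) :
  [/\ dens (schmidt2 t) ord0 ord0 = (cos t ^+ 2)%:C,
      dens (schmidt2 t) ord_max ord_max = (sin t ^+ 2)%:C
    & dens (schmidt2 t) ord0 ord_max = 0].
Proof.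
split; rewrite /dens !big_ord_recl big_ord0 /schmidt2 /=;
  by apply/eqP; rewrite eq_complex /=; apply/andP; split; apply/eqP; ring.
Qed.

Lemma schmidt2_unit (t : R) : unit_state (schmidt2 t).
Proof.
have [d0 d1 _] := schmidt2_dens t.
transitivity (dens (schmidt2 t) ord0 ord0 + dens (schmidt2 t) ord_max ord_max).
  rewrite /dens [LHS]big_ord_recl big_ord1; congr (_ + _).
by rewrite d0 d1 -rmorphD cos2Dsin2.
Qed.

Lemma schmidt2_bloch (t : R) :
  [/\ bloch1 (schmidt2 t) = 0, bloch2 (schmidt2 t) = 0 & bloch3 (schmidt2 t) = cos (t + t)].
Proof.
have [d0 d1 d2] := schmidt2_dens t.
rewrite /bloch1 /bloch2 /bloch3 d0 d1 d2 /= oppr0 mul0r; split => //.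
by rewrite cosD !expr2.
Qed.

Lemma reduced_herm x y z a b (phi : 'I_2 -> 'I_a -> C) (psi : 'I_2 -> 'I_b -> C) p q :
  reduced_BRB x y z phi psi p q = conjc (reduced_BRB x y z phi psi q p).
Proof.
rewrite /reduced_BRB rmorph_sum; apply: eq_bigr => i _; rewrite rmorph_sum; apply: eq_bigr => r _.
by rewrite /= rmorphM /= conjcK mulrC.
Qed.

Lemma log2_sum (I : finType) (l : I -> R) :
  - \sum_i l i * log2 (l i) = (- \sum_i l i * ln (l i)) / ln 2.
Proof.
by rewrite mulNr mulr_suml; congr (- _); apply: eq_bigr => i _; rewrite mulrA.
Qed.

Lemma ln2_ge0 : 0 <= (ln (2 : R))^-1.
Proof. by rewrite invr_ge0 ln_ge0 // ler1n. Qed.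

Section Fixed.
Variables x y : R.
Let sx := sin (x + x). Let cx := cos (x + x). Let sy := sin (y + y). Let cy := cos (y + y).
Hypotheses (cx0 : 0 <= cx) (cy0 : 0 <= cy) (sy0 : 0 < sy) (sysx : sy <= sx).

(** For an antiparallel input the quartic [\prod_k (1 + w * lam k)] splits into [1 + w p1 + w^2 d1]
    and [1 + w p2 + w^2 d2]: sums and products of two pairs of eigenvalues, recovered by
    [root_pair]. *)
Let p1 (u : R) : R := (1 + cx * cy - u * (sx * sy)) / 2.
Let d1 (u : R) : R := sy ^+ 2 * (1 + 2 * (cx * cy) + cy ^+ 2) * (1 - u) ^+ 2 / 16.
Let p2 (u : R) : R := (1 - cx * cy + u * (sx * sy)) / 2.
Let d2 (u : R) : R := sy ^+ 2 * (1 - 2 * (cx * cy) + cy ^+ 2) * (1 - u) ^+ 2 / 16.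

Definition root_pair (p d : R) (s : bool) : R :=
  (p + (if s then 1 else -1) * Num.sqrt (p ^+ 2 - 4 * d)) / 2.

Definition cand_spec (u : R) (i : bool * bool) : R :=
  if i.1 then root_pair (p1 u) (d1 u) i.2 else root_pair (p2 u) (d2 u) i.2.

Lemma root_pair_ge0 p d s : 0 <= p -> 0 <= d -> 0 <= root_pair p d s.
Proof.
move=> p0 d0; rewrite /root_pair mulr_ge0 ?invr_ge0 //.
have : Num.sqrt (p ^+ 2 - 4 * d) <= p.
  rewrite -[leRHS]ger0_norm // -sqrtr_sqr ler_wsqrtr //.
  by rewrite lerBlDr lerDl mulr_ge0.
have := sqrtr_ge0 (p ^+ 2 - 4 * d).
by case: s; move: (Num.sqrt _) => w; lra.
Qed.

Lemma root_pair_prod p d t : 4 * d <= p ^+ 2 ->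
  (1 + t * root_pair p d true) * (1 + t * root_pair p d false) = 1 + t * p + t ^+ 2 * d.
Proof.
move=> h; have := @sqr_sqrtr R (p ^+ 2 - 4 * d); rewrite subr_ge0 => /(_ h).
rewrite /root_pair; move: (Num.sqrt _) => w hw.
have -> : (1 + t * ((p + 1 * w) / 2)) * (1 + t * ((p + -1 * w) / 2)) =
  1 + t * p + t ^+ 2 * ((p ^+ 2 - w ^+ 2) / 4) by field.
by rewrite hw; field.
Qed.

Lemma big_bool2 (idx : R) (op : Monoid.com_law idx) (F : bool * bool -> R) :
  \big[op/idx]_i F i = op (op (F (true, true)) (F (true, false))) (op (F (false, true)) (F (false, false))).
Proof.
rewrite (eq_bigr (fun i => (fun a b => F (a, b)) i.1 i.2)); last by case.
by rewrite -(pair_bigA op (fun a b => F (a, b))) /= !big_bool.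
Qed.

Let xE : sx ^+ 2 + cx ^+ 2 = 1. Proof. by rewrite addrC cos2Dsin2. Qed.
Let yE : sy ^+ 2 + cy ^+ 2 = 1. Proof. by rewrite addrC cos2Dsin2. Qed.

(** Reality of both pairs at once; [m] and [sg] carry the sign that distinguishes them. The right
    side is at least [((1 + m) (1 - u))^2], and [(1 + m)^2 - sy^2 (1 + 2 m + cy^2) = cy^2 ((1 + m)^2
    - sg^2)]. *)
Lemma cand_disc (u m sg : R) : 0 <= u <= 1 -> 0 <= 1 + m -> 0 <= 1 + m - sg ->
  sg ^+ 2 <= (1 + m) ^+ 2 -> m ^+ 2 = (cx * cy) ^+ 2 -> sg ^+ 2 = (sx * sy) ^+ 2 ->
  sy ^+ 2 * (1 + 2 * m + cy ^+ 2) * (1 - u) ^+ 2 <= (1 + m - u * sg) ^+ 2.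
Proof.
move=> /andP[u0 u1] X0 Y0 sgX mE sgE.
have u1' : 0 <= 1 - u by rewrite subr_ge0.
apply: (@le_trans _ _ (((1 + m) * (1 - u)) ^+ 2)); last first.
  have h1 := mulr_ge0 u0 Y0; have h2 := mulr_ge0 X0 u1'.
  by rewrite ler_pXn2r ?nnegrE //; lra.
rewrite exprMn ler_wpM2r ?sqr_ge0 // -subr_ge0.
have -> : (1 + m) ^+ 2 - sy ^+ 2 * (1 + 2 * m + cy ^+ 2) = cy ^+ 2 * ((1 + m) ^+ 2 - sg ^+ 2).
  have cyE : cy ^+ 2 = 1 - sy ^+ 2 by rewrite -yE addrAC subrr add0r.
  have cxE : cx ^+ 2 = 1 - sx ^+ 2 by rewrite -xE addrAC subrr add0r.
  have -> : (1 + m) ^+ 2 - sy ^+ 2 * (1 + 2 * m + cy ^+ 2) =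
    (1 - sy ^+ 2) * (1 + m) ^+ 2 + sy ^+ 2 * m ^+ 2 - sy ^+ 2 * cy ^+ 2 by ring.
  rewrite mE sgE !exprMn cxE -cyE; ring.
by rewrite mulr_ge0 ?sqr_ge0 // subr_ge0.
Qed.

Let cs1 : cx * cy + sx * sy <= 1.
Proof. have := sqr_ge0 (cx - cy); have := sqr_ge0 (sx - sy); have := xE; have := yE; lra. Qed.
Let m0 : 0 <= cx * cy. Proof. exact: mulr_ge0. Qed.
Let sx0 : 0 <= sx. Proof. exact: le_trans (ltW sy0) sysx. Qed.
Let s0 : 0 <= sx * sy. Proof. by rewrite mulr_ge0 // ltW. Qed.

Lemma cand_bounds u : 0 <= u <= 1 ->
  [/\ 0 <= p1 u /\ 0 <= d1 u, 0 <= p2 u /\ 0 <= d2 u, 4 * d1 u <= p1 u ^+ 2 & 4 * d2 u <= p2 u ^+ 2].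
Proof.
move=> u01; have /andP[u0 u1] := u01.
have us : u * (sx * sy) <= sx * sy by rewrite ler_piMl.
have us0 : 0 <= u * (sx * sy) by rewrite mulr_ge0.
have c1 := cs1; have c2 := m0; have c3 := s0.
have dd (w : R) : 0 <= 1 + 2 * w + cy ^+ 2 -> 0 <= sy ^+ 2 * (1 + 2 * w + cy ^+ 2) * (1 - u) ^+ 2 / 16.
  by move=> hw; rewrite mulr_ge0 ?invr_ge0 // mulr_ge0 ?sqr_ge0 // mulr_ge0 ?sqr_ge0.
split.
- split; first by rewrite /p1; lra.
  by apply: dd; rewrite !addr_ge0 ?sqr_ge0 // mulr_ge0.
- split; first by rewrite /p2; lra.
  rewrite /d2 -[_ - _]/(1 + - (2 * (cx * cy))) -mulrN; apply: dd.
  have := sqr_ge0 (cy - cx); have := sqr_ge0 sx; have := xE; lra.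
- have h := @cand_disc u (cx * cy) (sx * sy) u01.
  rewrite /d1 /p1.
  have {}h : sy ^+ 2 * (1 + 2 * (cx * cy) + cy ^+ 2) * (1 - u) ^+ 2 <= (1 + cx * cy - u * (sx * sy)) ^+ 2.
    apply: h => //; try lra.
    by rewrite ler_pXn2r ?nnegrE //; lra.
  by move: h; lra.
- have h := @cand_disc u (- (cx * cy)) (- (sx * sy)) u01.
  have {}h : sy ^+ 2 * (1 + 2 * - (cx * cy) + cy ^+ 2) * (1 - u) ^+ 2 <= (1 + - (cx * cy) - u * - (sx * sy)) ^+ 2.
    apply: h; rewrite ?sqrrN //; try lra.
    by rewrite ler_pXn2r ?nnegrE //; lra.
  by move: h; rewrite /d2 /p2; lra.
Qed.

Let t := sx * cy. Let s := cx * sy. Let S := sy ^+ 2.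

Lemma cand_prod u w : 0 <= u <= 1 -> \prod_i (1 + w * cand_spec u i) =
  1 + w + w ^+ 2 * ((- S ^+ 2 * (1 - u) ^+ 2 + 4 * S * (1 - u) + 2 * (t + s * u) ^+ 2) / 8)
  + w ^+ 3 * (S * ((1 - u) ^+ 2 * (S + 2 * t * (t + s * u))) / 16)
  + w ^+ 4 * (S ^+ 2 * (S ^+ 2 + 4 * t ^+ 2) / 256 * ((1 - u) ^+ 2) ^+ 2).
Proof.
move=> u01; have [_ _ h1 h2] := cand_bounds u01.
rewrite big_bool2 /= /cand_spec /= !root_pair_prod //.
have [pp e2 e3 e4] : [/\ p1 u + p2 u = 1,
    p1 u * p2 u + d1 u + d2 u = (- S ^+ 2 * (1 - u) ^+ 2 + 4 * S * (1 - u) + 2 * (t + s * u) ^+ 2) / 8,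
    p1 u * d2 u + p2 u * d1 u = S * ((1 - u) ^+ 2 * (S + 2 * t * (t + s * u))) / 16
  & d1 u * d2 u = S ^+ 2 * (S ^+ 2 + 4 * t ^+ 2) / 256 * ((1 - u) ^+ 2) ^+ 2].
  move: xE yE; rewrite /p1 /d1 /p2 /d2 /S /t /s.
  move: sx cx sy cy => a b c d xE' yE'; split.
  - by field.
  - have := congr1 ( *%R (- (d ^+ 2 + c ^+ 2 * u ^+ 2) / 4)) xE'.
    have := congr1 ( *%R (- 1 / 4 + c ^+ 2 * (1 - u) ^+ 2 / 8)) yE'.
    lra.
  - have := congr1 ( *%R (- d ^+ 2 * c ^+ 2 * (1 - u) ^+ 2 / 8)) xE'.
    have := congr1 ( *%R (- c ^+ 2 * (1 - u) ^+ 2 / 16)) yE'.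
    lra.
  - have := congr1 ( *%R (- d ^+ 2 * c ^+ 4 * (1 - u) ^+ 4 / 64)) xE'.
    have := congr1 ( *%R (c ^+ 4 * (1 - u) ^+ 4 / 256 * (d ^+ 2 - 1 - c ^+ 2))) yE'.
    lra.
rewrite -e2 -e3 -e4.
have -> : (1 + w * p1 u + w ^+ 2 * d1 u) * (1 + w * p2 u + w ^+ 2 * d2 u) =
  1 + w * (p1 u + p2 u) + w ^+ 2 * (p1 u * p2 u + d1 u + d2 u) +
  w ^+ 3 * (p1 u * d2 u + p2 u * d1 u) + w ^+ 4 * (d1 u * d2 u) by ring.
by rewrite pp mulr1.
Qed.

Lemma cand_sum u : \sum_i cand_spec u i = 1.
Proof.
rewrite big_bool2 /= /cand_spec /= /root_pair.
by rewrite /p1 /p2; field.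
Qed.

Definition cand_entropy (u : R) : R := (- \sum_i cand_spec u i * ln (cand_spec u i)) / ln 2.

Lemma cand_ge0 u i : 0 <= u <= 1 -> 0 <= cand_spec u i.
Proof.
move=> u01; have [[h1 h2] [h3 h4] _ _] := cand_bounds u01.
by rewrite /cand_spec; case: ifP => _; apply: root_pair_ge0.
Qed.

Lemma Eout_le_cand a b (phi : 'I_2 -> 'I_a -> C) (psi : 'I_2 -> 'I_b -> C) :
  unit_state phi -> unit_state psi ->
  exists2 u, 0 <= u <= 1 & Eout x y y phi psi <= cand_entropy u.
Proof.
move=> phi1 psi1.
have [V [lam [dec EE]]] := vN_entropy_dec (reduced_herm x y y phi psi).
have l0 := lam_ge0 dec.
have l1 := lam_sum phi1 psi1 dec.
have lp := lam_prod phi1 psi1 dec.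
have [u [u01 hq h3 h2]] := @dominated_by_antiparallel R sx cx sy cy (bloch1 phi) (bloch2 phi) (bloch3 phi)
  (bloch1 psi) (bloch2 psi) (bloch3 psi) cx0 cy0 sy0 sysx xE yE (bloch_le1 phi1) (bloch_le1 psi1).
exists u => //.
rewrite /Eout EE log2_sum ler_wpM2r ?ln2_ge0 //.
apply: entropy_le_of_prod_le => //; first by move=> i; exact: cand_ge0.
  exact: cand_sum.
move=> w w0; rewrite lp cand_prod //.
have w0' := ltW w0.
have S0 : 0 <= sy ^+ 2 by exact: sqr_ge0.
have q0 : 0 <= (1 - (bloch1 phi ^+ 2 + bloch2 phi ^+ 2 + bloch3 phi ^+ 2)) *
   (1 - (bloch1 psi ^+ 2 + bloch2 psi ^+ 2 + bloch3 psi ^+ 2)).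
  by rewrite mulr_ge0 // subr_ge0 bloch_le1.
(* The comparison is made coefficient by coefficient in [w]; the last coefficient uses the square of
   [hq]. *)
apply: lerD; first apply: lerD; first apply: lerD => //.
- by rewrite ler_wpM2l ?exprn_ge0 // ler_wpM2r ?invr_ge0.
- by rewrite ler_wpM2l ?exprn_ge0 // ler_wpM2r ?invr_ge0 // ler_wpM2l.
- rewrite ler_wpM2l ?exprn_ge0 // ler_wpM2l //.
    by rewrite mulr_ge0 ?invr_ge0 // mulr_ge0 ?sqr_ge0 // addr_ge0 ?sqr_ge0 // mulr_ge0 ?sqr_ge0.
  by rewrite ler_pXn2r ?nnegrE ?sqr_ge0.
Qed.

Lemma Ephi_cand u : 0 <= u <= 1 -> exists alpha beta : R,
  [/\ 0 <= alpha <= pi / 2, 0 <= beta <= pi / 2 & Ephi x y y alpha beta = cand_entropy u].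
Proof.
move=> u01; have /andP[u0 u1] := u01.
have su : 0 <= Num.sqrt u <= 1 by rewrite sqrtr_ge0 -[1]sqrtr1 ler_wsqrtr.
have su' : -1 <= Num.sqrt u <= 1 by case/andP: su => h ->; rewrite andbT (le_trans _ h).
(* A Schmidt angle is half the polar angle of the Bloch vector, so [al] and [pi / 2 - al] give third
   components [sqrt u] and [- sqrt u]. *)
pose al : R := acos (Num.sqrt u) / 2.
have a0 := acos_ge0 su'; have api := acos_lepi su'.
have al2 : cos (al + al) = Num.sqrt u.
  rewrite (_ : al + al = acos (Num.sqrt u)); last by rewrite /al; field.
  by rewrite acosK // in_itv.
have be2 : cos ((pi / 2 - al) + (pi / 2 - al)) = - Num.sqrt u.
  rewrite -al2 (_ : pi / 2 - al + (pi / 2 - al) = pi - (al + al)); last by field.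
  by rewrite cosB cospi sinpi; ring.
exists al, (pi / 2 - al); split.
- by rewrite /al; lra.
- by rewrite /al; lra.
rewrite /Ephi /Eout.
have [p1u p2u] := (schmidt2_unit al, schmidt2_unit (pi / 2 - al)).
have [V [lam [dec EE]]] := vN_entropy_dec (reduced_herm x y y (schmidt2 al) (schmidt2 (pi / 2 - al))).
have l0 := lam_ge0 dec.
have l1 := lam_sum p1u p2u dec.
have pE w : \prod_k (1 + w * lam k) = \prod_i (1 + w * cand_spec u i).
  rewrite (lam_prod p1u p2u dec) cand_prod //.
  have [-> -> ->] := schmidt2_bloch al.
  have [-> -> ->] := schmidt2_bloch (pi / 2 - al).
  rewrite al2 be2 -/sx -/cx -/sy -/cy.
  have uE : Num.sqrt u ^+ 2 = u by rewrite sqr_sqrtr.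
  rewrite /S /t /s; move: (Num.sqrt u) sx cx sy cy uE => r a b c d <-.
  by field.
(* The eigenvalues are not matched one by one: equal products give the entropy inequality in both
   directions. *)
rewrite EE log2_sum; congr (_ / _); apply/eqP; rewrite eq_le; apply/andP; split;
  apply: entropy_le_of_prod_le => //; try by move=> i; exact: cand_ge0.
- exact: cand_sum.
- by move=> w _; rewrite pE.
- exact: cand_sum.
- by move=> w _; rewrite pE.
Qed.

Lemma continuous_root_pair (p d : R -> R) s' :
  continuous p -> continuous d -> continuous (fun u => root_pair (p u) (d u) s').
Proof.
move=> cp cd u; apply: cvgM; last exact: cvg_cst.
apply: cvgD; first exact: cp.
apply: cvgM; first exact: cvg_cst.
apply: (@continuous_comp _ _ _ (fun u => p u ^+ 2 - 4 * d u) (@Num.sqrt R)); last exact: sqrt_continuous.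
apply: cvgB; last by apply: cvgM; [exact: cvg_cst|exact: cd].
by apply: (@cvgM _ _ _ _ p p); exact: cp.
Qed.

Lemma continuous_cand_spec i : continuous (cand_spec ^~ i).
Proof.
have lin (a b k : R) : continuous (fun u : R => (a + b * (u * k)) / 2).
  move=> u; apply: cvgM; last exact: cvg_cst.
  apply: cvgD; first exact: cvg_cst.
  apply: cvgM; first exact: cvg_cst.
  by apply: cvgM; [exact: cvg_id|exact: cvg_cst].
have sq (k : R) : continuous (fun u : R => k * (1 - u) ^+ 2 / 16).
  move=> u; apply: cvgM; last exact: cvg_cst.
  apply: cvgM; first exact: cvg_cst.
  have c1 : continuous (fun v : R => 1 - v) by move=> v; apply: cvgB; [exact: cvg_cst|exact: cvg_id].
  by apply: (@cvgM _ _ _ _ (fun v : R => 1 - v) (fun v : R => 1 - v)); exact: c1.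
case: i => [[] s']; apply: continuous_root_pair; [| exact: sq | | exact: sq].
  rewrite (_ : p1 = fun u => (1 + cx * cy + -1 * (u * (sx * sy))) / 2); first exact: lin.
  by apply/funext => u; rewrite /p1 mulN1r.
rewrite (_ : p2 = fun u => (1 - cx * cy + 1 * (u * (sx * sy))) / 2); first exact: lin.
by apply/funext => u; rewrite /p2 mul1r.
Qed.

Lemma continuous_cand_entropy : continuous cand_entropy.
Proof.
have c i : continuous (fun u => cand_spec u i * ln (cand_spec u i)).
  move=> u; apply: (@continuous_comp _ _ _ (cand_spec ^~ i) (fun x : R => x * ln x)).
    exact: continuous_cand_spec.
  exact: continuous_xlnx.
move=> u; apply: cvgM; last exact: cvg_cst.
apply: cvgN.
rewrite (_ : (fun v => \sum_i _) = (fun v => cand_spec v (true, true) * ln (cand_spec v (true, true)) +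
  cand_spec v (true, false) * ln (cand_spec v (true, false)) +
  (cand_spec v (false, true) * ln (cand_spec v (false, true)) +
   cand_spec v (false, false) * ln (cand_spec v (false, false))))); last first.
  by apply/funext => v; rewrite big_bool2.
by rewrite big_bool2; apply: cvgD; apply: cvgD; apply: c.
Qed.

Lemma entangling_max : exists alpha beta : R,
  [/\ 0 <= alpha <= pi / 2, 0 <= beta <= pi / 2 &
   forall e, achievable x y y e -> e <= Ephi x y y alpha beta].
Proof.
have [u] := EVT_max (@ler01 R) (continuous_subspaceT continuous_cand_entropy).
rewrite in_itv => u01 umax.
have [al [be [al0 be0 E]]] := Ephi_cand u01.
exists al, be; split => // e [a [b [phi [psi [phi1 [psi1 ->]]]]]].
have [w w01 /le_trans] := Eout_le_cand phi1 psi1; apply; rewrite E.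
by apply: umax; rewrite in_itv.
Qed.

End Fixed.
End Final.

Theorem theorem1 (R : realType) (x y z : R) :
  pi / 4 >= x -> x >= y -> y >= z -> z >= 0 -> 0 < y -> y < pi / 4 ->
  coefU x y z 2 = coefU x y z 3 ->
  exists alpha beta : R,
    [/\ 0 <= alpha <= pi / 2, 0 <= beta <= pi / 2,
        (forall alpha' beta' : R, 0 <= alpha' <= pi / 2 -> 0 <= beta' <= pi / 2 ->
            Ephi x y z alpha' beta' <= Ephi x y z alpha beta),
        (forall e, achievable x y z e -> e <= Ephi x y z alpha beta)
      & KE x y z = Ephi x y z alpha beta].
Proof.
move=> x4 yx zy z0 y0 y4 c23.
have pi0 := pi_gt0 R.
(* The real parts of [c2 = c3] give [sin x * sin (y - z) = 0], with [sin x > 0] and [y - z] in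
   [[0, pi)]. *)
have yz : y = z.
  move: c23 => [h _].
  have sx : 0 < sin x by apply: sin_gt0_pi; lra.
  have : sin (y - z) = 0.
    by apply: (mulfI (lt0r_neq0 sx)); rewrite sinB; move: h; lra.
  have [//|yz] := eqVneq y z.
  have : 0 < sin (y - z) by apply: sin_gt0_pi; rewrite subr_gt0 lt_neqAle eq_sym yz zy /=; lra.
  by move=> + e0; rewrite e0 ltxx.
subst z.
have [al [be [al0 be0 H]]] : exists alpha beta : R,
  [/\ 0 <= alpha <= pi / 2, 0 <= beta <= pi / 2 &
   forall e, achievable x y y e -> e <= Ephi x y y alpha beta].
  apply: entangling_max.
  - by apply: cos_ge0_pihalf; lra.
  - by apply: cos_ge0_pihalf; lra.
  - by apply: sin_gt0_pi; lra.
  - rewrite leNgt ltr_sin ?in_itv /=; [|lra|lra].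
    by rewrite -leNgt; lra.
have ach al' be' : achievable x y y (Ephi x y y al' be').
  by exists 2%N, 2%N, (schmidt2 al'), (schmidt2 be'); split; [|split] => //; exact: schmidt2_unit.
exists al, be; split => //.
- by move=> *; apply: H; exact: ach.
- apply/eqP; rewrite eq_le; apply/andP; split.
    by apply: ge_sup; [exists (Ephi x y y al be); exact: ach|move=> e /H].
  by apply: ub_le_sup; [exists (Ephi x y y al be) => e /H|exact: ach].
Qed.
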